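(* If $x\neq 0$, then the algebra $\mathbb{L}_n(x)$ is semisimple.
   Context: Let $K$ be a field, $x$ an element transcendental or algebraic over $K$, and $F=K(x)$, assumed of characteristic zero; ''semisimple'' means isomorphic to a finite direct product of full matrix algebras over $F$. Let $\mathscr{A}_n$ be the set of graphs on $\{1,\dots,n\}\cup\{1',\dots,n'\}$ (top row $1,\dots,n$, bottom row $1',\dots,n'$) in which every vertex has degree $0$ or $1$ (degree-$0$ vertices are said to carry loops). Arcs within a row are horizontal, arcs between rows vertical. For diagrams $\mathfrak a,\mathfrak b$, stack $\mathfrak a$ above $\mathfrak b$ identifying bottom vertex $i'$ of $\mathfrak a$ with top vertex $i$ of $\mathfrak b$; let $\ell(\mathfrak a,\mathfrak b)$ be the number of components lying entirely in the middle row and $G'(\mathfrak a,\mathfrak b)$ the diagram on the outer rows joining two vertices iff they are connected by a path; set $\mathfrak a\mathfrak b=x^{\ell(\mathfrak a,\mathfrak b)}G'(\mathfrak a,\mathfrak b)$. $\mathbb{L}_n(x)$ is the $F$-algebra with basis the diagrams in $\mathscr{A}_n$ having no horizontal arcs and this (bilinearly extended) product. *)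

(* Defs.v *)
From HB Require Import structures.
From mathcomp Require Import all_boot all_order all_algebra.
Set Implicit Arguments. Unset Strict Implicit. Unset Printing Implicit Defensive.
Import GRing.Theory.
Local Open Scope ring_scope.

(* A diagram of A_n with no horizontal arcs is a partial bijection between the
   top row {1..n} and the bottom row {1'..n'}: top vertex i is joined to
   bottom vertex j' iff  f i = Some j; f i = None means i carries a loop
   (degree 0); bottom vertices not in the image of f carry loops. *)
Definition pinjb n (f : {ffun 'I_n -> option 'I_n}) : bool :=
  [forall i, forall j, (f i != None) && (f i == f j) ==> (i == j)].

Definition rook n := {f : {ffun 'I_n -> option 'I_n} | pinjb f}.

(* G'(a,b): stacking a above b; top i -> a's bottom j' = b's top j -> b's bottom k'. *)
Definition rook_comp n (a b : rook n) : {ffun 'I_n -> option 'I_n} :=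
  [ffun i => obind (fun j => val b j) (val a i)].

(* l(a,b): number of middle-row vertices j that are isolated in both a
   (not a bottom endpoint of a) and b (not a top endpoint of b). *)
Definition rook_loops n (a b : rook n) : nat :=
  #|[pred j : 'I_n | [forall i, val a i != Some j] && (val b j == None)]|.

Notation Ln F n := {ffun rook n -> F}.

Definition Ln_mul (F : fieldType) n (x : F) (u v : Ln F n) : Ln F n :=
  [ffun w : rook n => \sum_(a : rook n) \sum_(b : rook n | rook_comp a b == val w)
      u a * v b * x ^+ rook_loops a b].

Definition Ln_one (F : fieldType) n : Ln F n :=
  [ffun w : rook n => (val w == [ffun i => Some i])%:R].

Definition Ln_semisimple (F : fieldType) n (x : F) : Prop :=
  exists k (d : 'I_k -> nat) (phi : Ln F n -> forall i : 'I_k, 'M[F]_(d i)),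
    [/\ forall i, (0 < d i)%N,
        forall (c : F) (u v : Ln F n) i, phi [ffun w => c * u w + v w] i = c *: phi u i + phi v i,
        forall (u v : Ln F n) i, phi (Ln_mul x u v) i = phi u i *m phi v i,
        forall i, phi (Ln_one F n) i = 1%:M
      & bijective phi].

(* Main.v *)
(* Rescaling a diagram d of rank k to x^(n-k) times the sum of its restrictions
   turns the twisted product into the algebra of the groupoid of partial
   bijections of {1..n}; this is invertible because x <> 0.  The groupoid is
   equivalent to the disjoint union of the symmetric groups S_0, ..., S_n, so it
   suffices to split the algebras F[S_r] over F itself.  This is Young's theorem:
   for tableaux of shapes lambda and mu, the Young symmetrizers satisfy
   c_lambda A c_lambda = F c_lambda, and c_lambda A c_mu = 0 when lambda <> mu,
   since a nonzero product forces domination in both directions.  In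
   characteristic zero an element with square zero has coefficient 0 at the
   identity (its trace in the regular representation vanishes), so each c_lambda
   is a multiple of an idempotent and the sums over the conjugates of the
   c_lambda are linearly independent class functions.  There are as many of them
   as conjugacy classes, hence 1 lies in the ideal that the c_lambda generate.
   An algebra with idempotents e_i such that e_i A e_j is F e_i or 0 according to
   whether i = j, and which generate the unit ideal, is the product of the
   algebras End_F(A e_i). *)
From HB Require Import structures.
Require Import Defs.
From mathcomp Require Import all_boot all_order all_fingroup all_algebra.
From mathcomp Require Import zify.
From Stdlib Require Import FunctionalExtensionality.
Set Implicit Arguments. Unset Strict Implicit. Unset Printing Implicit Defensive.
Import GRing.Theory.
Local Open Scope ring_scope.

(** * Algebras of finite categories *)

(** Objects are represented by their identity arrows. Composition is partial and reads from left to
    right, [None] meaning that the two arrows do not meet. Finite groups and the groupoid of partial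
    bijections are both instances. *)
Record fincat := FinCat {
  arrow :> finType;
  comp : arrow -> arrow -> option arrow;
  idents : {set arrow};
  src : arrow -> arrow;
  tgt : arrow -> arrow;
  compA : forall a b c, obind (comp a) (comp b c) = obind (comp^~ c) (comp a b);
  src_ident : forall a, src a \in idents;
  tgt_ident : forall a, tgt a \in idents;
  comp_idl : forall e a, e \in idents ->
    comp e a = if e == src a then Some a else None;
  comp_idr : forall e a, e \in idents ->
    comp a e = if e == tgt a then Some a else None;
  some_ident : exists e, e \in idents
}.

Definition catalg (F : fieldType) (C : fincat) := {ffun C -> F^o}.

HB.instance Definition _ F C := GRing.Lmodule.on (catalg F C).
HB.instance Definition _ F C := Vector.on (catalg F C).

Section CatAlg.
Variables (F : fieldType) (C : fincat).
Local Notation A := (catalg F C).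

Definition delta (a : C) : A := [ffun t => (t == a)%:R].
Definition odelta (o : option C) : A := oapp delta 0 o.

Lemma deltaE (u : A) : u = \sum_a u a *: delta a.
Proof.
apply/ffunP=> t; rewrite sum_ffunE (bigD1 t) //= big1 => [|a nat].
  by rewrite !ffunE eqxx addr0 /GRing.scale /= mulr1.
by rewrite !ffunE eq_sym (negPf nat) scaler0.
Qed.

Lemma sum_deltaE (P : pred C) : \sum_(a | P a) delta a = [ffun t => (P t)%:R].
Proof.
apply/ffunP=> t; rewrite sum_ffunE ffunE; case: (boolP (P t)) => Pt.
  rewrite (bigD1 t) //= ffunE eqxx big1 ?addr0 // => a /andP[_ nat].
  by rewrite ffunE eq_sym (negPf nat).
rewrite big1 // => a Pa; rewrite ffunE; case: eqP => // eta.
by rewrite eta Pa in Pt.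
Qed.

Definition catalg_mul (u v : A) : A :=
  locked (\sum_a \sum_b (u a * v b) *: odelta (comp a b)).

Definition catalg_one : A := \sum_(e in idents C) delta e.

Lemma catalg_mulDl : left_distributive catalg_mul +%R.
Proof.
move=> u v w; rewrite /catalg_mul -!lock -big_split; apply: eq_bigr => a _ /=.
by rewrite -big_split; apply: eq_bigr => b _ /=; rewrite ffunE mulrDl scalerDl.
Qed.

Lemma catalg_mulDr : right_distributive catalg_mul +%R.
Proof.
move=> u v w; rewrite /catalg_mul -!lock -big_split; apply: eq_bigr => a _ /=.
by rewrite -big_split; apply: eq_bigr => b _ /=; rewrite ffunE mulrDr scalerDl.
Qed.

Lemma catalg_mulZl k u v : k *: catalg_mul u v = catalg_mul (k *: u) v.
Proof.
rewrite /catalg_mul -!lock scaler_sumr; apply: eq_bigr => a _; rewrite scaler_sumr.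
by apply: eq_bigr => b _; rewrite ffunE scalerA mulrA.
Qed.

Lemma catalg_mulZr k u v : k *: catalg_mul u v = catalg_mul u (k *: v).
Proof.
rewrite /catalg_mul -!lock scaler_sumr; apply: eq_bigr => a _; rewrite scaler_sumr.
by apply: eq_bigr => b _; rewrite ffunE scalerA mulrCA.
Qed.

Lemma catalg_mul0l v : catalg_mul 0 v = 0.
Proof. by rewrite -[in LHS](scale0r 0) -catalg_mulZl scale0r. Qed.

Lemma catalg_mul0r v : catalg_mul v 0 = 0.
Proof. by rewrite -[in LHS](scale0r 0) -catalg_mulZr scale0r. Qed.

Lemma catalg_mul_suml I r (P : pred I) (f : I -> A) v :
  catalg_mul (\sum_(i <- r | P i) f i) v = \sum_(i <- r | P i) catalg_mul (f i) v.
Proof.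
by apply: (big_morph (catalg_mul^~ v)) => [u w|]; [exact: catalg_mulDl | exact: catalg_mul0l].
Qed.

Lemma catalg_mul_sumr I r (P : pred I) (f : I -> A) v :
  catalg_mul v (\sum_(i <- r | P i) f i) = \sum_(i <- r | P i) catalg_mul v (f i).
Proof.
by apply: (big_morph (catalg_mul v)) => [u w|]; [exact: catalg_mulDr | exact: catalg_mul0r].
Qed.

Lemma catalg_mul_delta a b : catalg_mul (delta a) (delta b) = odelta (comp a b).
Proof.
rewrite /catalg_mul -lock (bigD1 a) //= [X in _ + X]big1 => [|a' na]; last first.
  by rewrite big1 // => b' _; rewrite ffunE (negPf na) mul0r scale0r.
rewrite addr0 (bigD1 b) //= big1 => [|b' nb]; last first.
  by rewrite !ffunE (negPf nb) mulr0 scale0r.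
by rewrite !ffunE !eqxx mulr1 scale1r addr0.
Qed.

(** Both sides are trilinear, so the arguments are reduced one at a time to basis arrows; there the
    claim is [compA], an undefined composite counting as 0. *)
Lemma catalg_mulA : associative catalg_mul.
Proof.
have mulA3 a b c : catalg_mul (delta a) (catalg_mul (delta b) (delta c))
    = catalg_mul (catalg_mul (delta a) (delta b)) (delta c).
  rewrite !catalg_mul_delta; have := compA a b c.
  case: (comp b c) => [bc|] /=; case: (comp a b) => [ab|] /=.
  - by rewrite !catalg_mul_delta => ->.
  - by rewrite catalg_mul_delta => ->; rewrite catalg_mul0l.
  - by rewrite catalg_mul_delta => <-; rewrite catalg_mul0r.
  - by rewrite catalg_mul0r catalg_mul0l.
have mulA2 a b w : catalg_mul (delta a) (catalg_mul (delta b) w)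
    = catalg_mul (catalg_mul (delta a) (delta b)) w.
  rewrite (deltaE w) !catalg_mul_sumr.
  apply: eq_bigr => c _.
  by rewrite -!catalg_mulZr mulA3.
have mulA1 a v w : catalg_mul (delta a) (catalg_mul v w)
    = catalg_mul (catalg_mul (delta a) v) w.
  rewrite (deltaE v) (catalg_mul_suml _ _ _ w) !catalg_mul_sumr.
  rewrite catalg_mul_suml.
  apply: eq_bigr => b _.
  by rewrite -catalg_mulZl -!catalg_mulZr -catalg_mulZl mulA2.
move=> u v w; rewrite (deltaE u) !catalg_mul_suml; apply: eq_bigr => a _.
by rewrite -!catalg_mulZl mulA1.
Qed.

Lemma catalg_mul1l : left_id catalg_one catalg_mul.
Proof.
move=> u; rewrite [u in LHS]deltaE catalg_mul_sumr [RHS]deltaE.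
apply: eq_bigr => a _; rewrite -catalg_mulZr /catalg_one catalg_mul_suml.
rewrite (bigD1 (src a)) ?src_ident //= big1 => [|e /andP[eid ne]];
  rewrite catalg_mul_delta comp_idl ?src_ident ?eqxx ?addr0 //.
by rewrite (negPf ne).
Qed.

Lemma catalg_mul1r : right_id catalg_one catalg_mul.
Proof.
move=> u; rewrite [u in LHS]deltaE catalg_mul_suml [RHS]deltaE.
apply: eq_bigr => a _; rewrite -catalg_mulZl /catalg_one catalg_mul_sumr.
rewrite (bigD1 (tgt a)) ?tgt_ident //= big1 => [|e /andP[eid ne]];
  rewrite catalg_mul_delta comp_idr ?tgt_ident ?eqxx ?addr0 //.
by rewrite (negPf ne).
Qed.

Lemma catalg_one_neq0 : catalg_one != 0.
Proof.
have [e eid] := some_ident C; apply/eqP => /ffunP/(_ e).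
by rewrite /catalg_one sum_deltaE !ffunE eid => /eqP; rewrite oner_eq0.
Qed.

HB.instance Definition _ := GRing.Zmodule_isNzRing.Build A
  catalg_mulA catalg_mul1l catalg_mul1r catalg_mulDl catalg_mulDr catalg_one_neq0.
HB.instance Definition _ := GRing.Lmodule_isLalgebra.Build F A catalg_mulZl.
HB.instance Definition _ := GRing.Lalgebra_isAlgebra.Build F A catalg_mulZr.

Lemma catalg_1E : 1 = \sum_(e in idents C) delta e :> A.
Proof. by []. Qed.

Lemma delta_mul a b : delta a * delta b = odelta (comp a b) :> A.
Proof. exact: catalg_mul_delta. Qed.

End CatAlg.

(** * Split algebras from primitive idempotents *)

(** The two-sided ideal generated by the [e i]. Being inductive, it allows identities to be checked
    on generators once 1 is known to belong to it. *)
Inductive ideal (R : nzRingType) (I : Type) (e : I -> R) : R -> Prop :=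
| ideal0 : ideal e 0
| idealD u v : ideal e u -> ideal e v -> ideal e (u + v)
| ideal_gen l i r : ideal e (l * e i * r).

(** The spaces [e i * A * e j] are the homomorphisms between the left ideals [A * e i] and
    [A * e j]: scalars if [i = j], zero otherwise. *)
Definition split_family (F : fieldType) (A : algType F) (I : eqType) (e : I -> A) :=
  [/\ forall i, e i != 0,
      forall i, e i * e i = e i,
      forall i a, exists k, e i * a * e i = k *: e i,
      forall i j a, i != j -> e i * a * e j = 0
    & ideal e 1].

Section Split.
Variables (F : fieldType) (A : algType F) (I : finType) (e : I -> A).
Variables (N : nat) (bas : 'I_N -> A).
Hypothesis bas_span : forall a, exists f : 'I_N -> F, a = \sum_k f k *: bas k.
Hypothesis e_split : split_family e.

Let e_neq0 i : e i != 0. Proof. by have [] := e_split. Qed.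
Let e_idem i : e i * e i = e i. Proof. by have [] := e_split. Qed.
Let e_orth i j a : i != j -> e i * a * e j = 0.
Proof. by have [_ _ _ + _] := e_split; apply. Qed.
Let e_full : ideal e 1. Proof. by have [] := e_split. Qed.

Let corner_ex i a : exists k, e i * a * e i == k *: e i.
Proof. by have [_ _ /(_ i a)[k ->] _ _] := e_split; exists k. Qed.

Definition corner i a : F := xchoose (corner_ex i a).

Lemma cornerE i a : e i * a * e i = corner i a *: e i.
Proof. exact/eqP/(xchooseP (corner_ex i a)). Qed.

Lemma scale_inj i (k l : F) : k *: e i = l *: e i -> k = l.
Proof.
move/eqP; rewrite -subr_eq0 -scalerBl scaler_eq0 (negPf (e_neq0 i)) orbF subr_eq0.
by move/eqP.
Qed.

Lemma corner_eq i a k : e i * a * e i = k *: e i -> corner i a = k.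
Proof. by rewrite cornerE; apply: scale_inj. Qed.

Lemma corner_is_linear i : scalar (corner i).
Proof.
move=> k u v; apply: corner_eq.
by rewrite mulrDr mulrDl -scalerAr -scalerAl !cornerE scalerA -scalerDl.
Qed.

HB.instance Definition _ i :=
  GRing.isLinear.Build F A F _ (corner i) (corner_is_linear i).

(** Matrix of the pairing between [e i * A] and [A * e i] on the spanning families [e i * bas s] and
    [bas t * e i]. Its rank is the dimension of [A * e i], and its rank factorization, inverted on
    each side, yields dual bases. *)
Definition gram i : 'M[F]_N := \matrix_(s, t) corner i (bas s * bas t).
Definition deg i := \rank (gram i).
Definition gramL i : 'M[F]_(deg i, N) := pinvmx (col_base (gram i)).
Definition gramR i : 'M[F]_(N, deg i) := pinvmx (row_base (gram i)).

Lemma gramLK i : gramL i *m gram i = row_base (gram i).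
Proof.
by rewrite -[X in _ *m X]mulmx_base mulmxA mulVpmx ?mul1mx // col_base_full.
Qed.

Lemma gramRK i : gram i *m gramR i = col_base (gram i).
Proof.
by rewrite -[X in X *m _]mulmx_base -mulmxA mulmxVp ?mulmx1 // row_base_free.
Qed.

(* [ket] is a basis of the left ideal [A e_i] and [bra] the dual basis of
   [e_i A] for the pairing given by [corner i]. *)
Definition ket i k : A := locked (\sum_t gramR i t k *: (bas t * e i)).
Definition bra i k : A := locked (\sum_s gramL i k s *: (e i * bas s)).
Arguments ket : clear implicits.
Arguments bra : clear implicits.

Lemma braE i k : e i * bra i k = bra i k.
Proof.
rewrite /bra -lock mulr_sumr; apply: eq_bigr => s _.
by rewrite -scalerAr mulrA e_idem.
Qed.

Lemma ketE i k : ket i k * e i = ket i k.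
Proof.
rewrite /ket -lock mulr_suml; apply: eq_bigr => s _.
by rewrite -scalerAl -mulrA e_idem.
Qed.

Lemma bra_basE i k t : bra i k * (bas t * e i) = row_base (gram i) k t *: e i.
Proof.
rewrite /bra -lock mulr_suml -gramLK mxE scaler_suml; apply: eq_bigr => s _.
rewrite -scalerAl mulrA -(mulrA _ (bas s)) cornerE scalerA. by rewrite [gram _ _ _]mxE.
Qed.

Lemma bas_ketE i s l : e i * bas s * ket i l = col_base (gram i) s l *: e i.
Proof.
rewrite /ket -lock mulr_sumr -gramRK mxE scaler_suml; apply: eq_bigr => t _.
by rewrite -scalerAr mulrA -(mulrA _ (bas s)) cornerE scalerA [gram _ _ _]mxE mulrC.
Qed.

(** The pairing matrix is [gramL * gram * gramR], that is [row_base * gramR], the identity. *)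
Lemma bra_ket i k l : bra i k * ket i l = (k == l)%:R *: e i.
Proof.
rewrite {1}/ket -lock mulr_sumr; under eq_bigr do rewrite -scalerAr bra_basE scalerA mulrC.
rewrite -scaler_suml; congr (_ *: _).
have /matrixP/(_ k l) : row_base (gram i) *m gramR i = 1%:M.
  by rewrite mulmxVp // row_base_free.
rewrite !mxE => <-. by apply: eq_bigr.
Qed.

Lemma bra_ket_neq i j a k l : i != j -> bra i k * a * ket j l = 0.
Proof.
move=> nij; rewrite -braE -ketE mulrA -(mulrA (e i)) -(mulrA (e i)) e_orth ?mul0r //.
Qed.

(** Nondegeneracy of the pairings: expanding [1 * v] along the membership of 1 in the ideal, every
    generator [l * e i * r] kills [v]. *)
Lemma ideal_annihil v : (forall i a, e i * a * v = 0) -> v = 0.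
Proof.
move=> ev0; rewrite -[v]mul1r; elim: e_full => [|u w _ IHu _ IHw|l i r].
- by rewrite mul0r.
- by rewrite mulrDl IHu IHw addr0.
- by rewrite -!mulrA (mulrA (e i)) ev0 mulr0.
Qed.

(** The difference [w] of the two sides lies in [A * e i]. It is killed by [e j * A], by
    orthogonality if [j] differs from [i], and by the rank factorization of the Gram matrix if
    [j = i]. *)
Lemma ket_bra_sum_id i t : (\sum_k ket i k * bra i k) * (bas t * e i) = bas t * e i.
Proof.
apply/eqP; rewrite -subr_eq0; apply/eqP/ideal_annihil => j a.
set w := _ - _.
have we : w * e i = w by rewrite /w mulrBl -!mulrA e_idem.
case: (eqVneq i j) => [eij|nij]; last first.
  by rewrite -we mulrA -(mulrA (e j)) e_orth // eq_sym.
rewrite -{j}eij; have [f ->] := bas_span a.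
rewrite mulr_sumr mulr_suml big1 // => s _.
rewrite -scalerAr -scalerAl (_ : _ * w = 0) ?scaler0 //.
rewrite /w mulrBr mulr_suml mulr_sumr.
under eq_bigr do rewrite -mulrA bra_basE -scalerAr ketE -scalerAr bas_ketE scalerA.
rewrite -scaler_suml mulrA -(mulrA _ (bas s)) cornerE -scalerBl.
have /matrixP/(_ s t) := mulmx_base (gram i).
rewrite [gram _ _ _]mxE mxE => <-; apply/eqP.
rewrite scaler_eq0 subr_eq0; apply/orP; left; apply/eqP.
by apply: eq_bigr => k _; rewrite mulrC.
Qed.

Lemma ket_bra_sum_idl i r : (\sum_k ket i k * bra i k) * (r * e i) = r * e i.
Proof.
have [f ->] := bas_span r; rewrite (mulr_suml _ _ _ (e i)) mulr_sumr; apply: eq_bigr => t _.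
by rewrite -scalerAl -scalerAr ket_bra_sum_id.
Qed.

(** Multiplication by the sum [z] fixes each generator [l * e i * r], since only its [i]-th part
    acts on it; hence [z * 1 = 1]. *)
Lemma ket_bra_sum1 : \sum_i \sum_k ket i k * bra i k = 1.
Proof.
set z := LHS; rewrite -[z]mulr1; elim: e_full => [|u w _ IHu _ IHw|l i r].
- by rewrite mulr0.
- by rewrite mulrDr IHu IHw.
rewrite mulrA; congr (_ * _); rewrite /z mulr_suml (bigD1 i) //= ket_bra_sum_idl.
rewrite big1 ?addr0 // => j nji; rewrite mulr_suml big1 // => k _.
by rewrite -mulrA -braE (mulrA _ l) -(mulrA (e j)) e_orth // mulr0.
Qed.

(** The matrix of left multiplication by [a] on [A * e i] in the basis [ket]. *)
Definition coefs (a : A) i : 'M[F]_(deg i) :=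
  \matrix_(k, l) corner i (bra i k * a * ket i l).

Definition combine (M : forall i, 'M[F]_(deg i)) : A :=
  \sum_i \sum_k \sum_l M i k l *: (ket i k * bra i l).

Lemma coefs_eq i a k l c : bra i k * a * ket i l = c *: e i -> coefs a i k l = c.
Proof.
move=> eqc; rewrite mxE; apply: corner_eq.
by rewrite eqc -scalerAr -scalerAl !e_idem.
Qed.

Lemma coefsE i a k l : bra i k * a * ket i l = coefs a i k l *: e i.
Proof. by rewrite mxE -cornerE -!mulrA ketE !mulrA braE. Qed.

Lemma coefsK a : combine (coefs a) = a.
Proof.
rewrite -[RHS]mul1r -[RHS]mulr1 -ket_bra_sum1 !mulr_suml; apply: eq_bigr => i _.
rewrite mulr_sumr (bigD1 i) //= [X in _ + X]big1 ?addr0 => [|j nji]; last first.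
  rewrite mulr_suml mulr_suml big1 // => k _; rewrite mulr_sumr big1 // => l _.
  by rewrite mulrA -(mulrA (ket i k)) -(mulrA (ket i k)) bra_ket_neq 1?eq_sym // mulr0 mul0r.
rewrite !mulr_suml; apply: eq_bigr => k _; rewrite mulr_sumr; apply: eq_bigr => l _.
rewrite mulrA -(mulrA (ket i k)) -(mulrA (ket i k)) coefsE.
by rewrite -scalerAr -scalerAl ketE.
Qed.

Lemma coefsP c u v i : coefs (c *: u + v) i = c *: coefs u i + coefs v i.
Proof.
apply/matrixP=> k l; rewrite !mxE mulrDr mulrDl -scalerAr -scalerAl.
by rewrite linearP.
Qed.

Lemma coefsM u v i : coefs (u * v) i = coefs u i *m coefs v i.
Proof.
apply/matrixP=> k l; rewrite [RHS]mxE; apply: coefs_eq.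
rewrite -[u in LHS]mulr1 -ket_bra_sum1 mulr_sumr mulr_suml mulr_sumr mulr_suml.
rewrite (bigD1 i) //= [X in _ + X]big1 ?addr0 => [|j nji]; last first.
  rewrite mulr_sumr mulr_suml mulr_sumr mulr_suml big1 // => m _.
  by rewrite !mulrA bra_ket_neq 1?eq_sym // !mul0r.
rewrite mulr_sumr mulr_suml mulr_sumr mulr_suml scaler_suml; apply: eq_bigr => m _.
rewrite !mulrA coefsE -2!mulrA (mulrA (bra i m)) coefsE.
by rewrite -scalerAl -scalerAr e_idem scalerA.
Qed.

Lemma coefs1 i : coefs 1 i = 1%:M.
Proof. by apply/matrixP=> k l; rewrite [RHS]mxE; apply: coefs_eq; rewrite mulr1 bra_ket. Qed.

Lemma combineK M i : coefs (combine M) i = M i.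
Proof.
apply/matrixP=> k l; apply: coefs_eq.
rewrite mulr_sumr mulr_suml (bigD1 i) //= [X in _ + X]big1 ?addr0 => [|j nji]; last first.
  rewrite mulr_sumr mulr_suml big1 // => k' _; rewrite mulr_sumr mulr_suml big1 // => l' _.
  by rewrite -scalerAr -scalerAl mulrA -[bra i k]mulr1 bra_ket_neq 1?eq_sym // !mul0r scaler0.
rewrite mulr_sumr mulr_suml (bigD1 k) //= [X in _ + X]big1 ?addr0 => [|k' nk]; last first.
  rewrite mulr_sumr mulr_suml big1 // => l' _.
  by rewrite -scalerAr -scalerAl mulrA bra_ket eq_sym (negPf nk) scale0r !mul0r scaler0.
rewrite mulr_sumr mulr_suml (bigD1 l) //= [X in _ + X]big1 ?addr0 => [|l' nl]; last first.
  by rewrite -scalerAr -scalerAl mulrA -(mulrA _ (bra i l')) (bra_ket l')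
    (negPf nl) scale0r mulr0 scaler0.
by rewrite -scalerAr -scalerAl mulrA -(mulrA _ (bra i l)) !bra_ket !eqxx !scale1r e_idem.
Qed.

(** A zero Gram matrix would make [corner i] vanish on all products, but its value at [e i * e i] is
    1. *)
Lemma deg_gt0 i : (0 < deg i)%N.
Proof.
rewrite lt0n mxrank_eq0; apply/eqP => g0.
have e0 k t : corner i (bas k * bas t) = 0.
  by move/matrixP/(_ k t): g0; rewrite !mxE.
have [f ef] := bas_span (e i).
have : corner i (e i * e i) = 0.
  rewrite ef mulr_suml linear_sum big1 // => s _.
  rewrite mulr_sumr linear_sum big1 // => t _.
  by rewrite -scalerAl -scalerAr !linearZ /= e0 !mulr0.
rewrite (corner_eq (k := 1)); first by move/eqP; rewrite oner_eq0.
by rewrite scale1r !e_idem.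
Qed.

Theorem split_family_semisimple :
  exists (d : I -> nat) (phi : A -> forall i, 'M[F]_(d i)),
    [/\ forall i, (0 < d i)%N,
        forall c u v i, phi (c *: u + v) i = c *: phi u i + phi v i,
        forall u v i, phi (u * v) i = phi u i *m phi v i,
        forall i, phi 1 i = 1%:M
      & bijective phi].
Proof.
exists deg, coefs; split; [exact: deg_gt0 | exact: coefsP | exact: coefsM | exact: coefs1|].
exists combine; first exact: coefsK.
by move=> M; apply: functional_extensionality_dep => i; apply: combineK.
Qed.

End Split.

(** * Group algebras in characteristic zero *)

(** For a rank factorization M = C R, one-sided inverses of C and R turn C R C R = 0 into R C = 0,
    and C R and R C have the same trace. *)
Lemma mxtrace_sqr0 (F : fieldType) N (M : 'M[F]_N) : M *m M = 0 -> \tr M = 0.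
Proof.
move=> MM0; rewrite -(mulmx_base M) mxtrace_mulC.
suff -> : row_base M *m col_base M = 0 by rewrite mxtrace0.
have := mulmxVp (row_base_free M); have := mulVpmx (col_base_full M).
have := mulmx_base M.
move: (col_base M) (row_base M) (pinvmx (col_base M)) (pinvmx (row_base M)).
move: (\rank M) => r C R C' R' MCR C'K RK.
have := congr1 (fun B => C' *m B *m R') MM0.
rewrite -MCR mulmx0 mul0mx => <-.
by rewrite !mulmxA C'K mul1mx -!mulmxA RK mulmx1.
Qed.

Lemma idealZ (F : fieldType) (A : algType F) (I : Type) (e : I -> A) k u :
  ideal e u -> ideal e (k *: u).
Proof.
elim=> [|{}u v _ IHu _ IHv|l i r]; first by rewrite scaler0; apply: ideal0.
  by rewrite scalerDr; apply: idealD.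
by rewrite scalerAl scalerAl; apply: ideal_gen.
Qed.

Lemma ideal_sum (R : nzRingType) (I : Type) (e : I -> R) (J : Type) r (P : pred J) f :
  (forall j, P j -> ideal e (f j)) -> ideal e (\sum_(j <- r | P j) f j).
Proof.
move=> ef; elim/big_rec: _ => [|j u Pj IHu]; first exact: ideal0.
by apply: idealD => //; apply: ef.
Qed.

Section GroupCat.
Variable gT : finGroupType.
Local Open Scope group_scope.

Definition gcomp (a b : gT) := Some (a * b).

Lemma gcompA a b c : obind (gcomp a) (gcomp b c) = obind (gcomp^~ c) (gcomp a b).
Proof. by rewrite /gcomp /= mulgA. Qed.

Lemma gcomp_idl e a : e \in [set 1] -> gcomp e a = if e == 1 then Some a else None.
Proof. by rewrite inE /gcomp => /eqP->; rewrite eqxx mul1g. Qed.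

Lemma gcomp_idr e a : e \in [set 1] -> gcomp a e = if e == 1 then Some a else None.
Proof. by rewrite inE /gcomp => /eqP->; rewrite eqxx mulg1. Qed.

Lemma gsome_ident : exists e : gT, e \in [set 1].
Proof. by exists 1; rewrite inE. Qed.

Definition groupcat : fincat :=
  @FinCat gT gcomp [set 1] (fun _ => 1) (fun _ => 1) gcompA
    (fun _ => set11 1) (fun _ => set11 1) gcomp_idl gcomp_idr gsome_ident.

End GroupCat.

Section GroupAlg.
Variables (F : fieldType) (gT : finGroupType).
Local Notation A := (catalg F (groupcat gT)).
Local Notation "''d' g" := (delta F (g : groupcat gT)) (at level 8, g at level 2).

Lemma gdeltaM (g h : gT) : 'd g * 'd h = 'd (g * h)%g :> A.
Proof. by rewrite delta_mul. Qed.

Lemma gdelta1 : 'd 1%g = 1 :> A.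
Proof. by rewrite catalg_1E /= big_set1. Qed.

Lemma gdeltaMl (g t : gT) (u : A) : ('d g * u) t = u (g^-1 * t)%g.
Proof.
rewrite [u in LHS]deltaE mulr_sumr sum_ffunE (bigD1 (g^-1 * t)%g) //= big1 => [|h nh].
  by rewrite -scalerAr gdeltaM !ffunE mulKVg eqxx addr0 /GRing.scale /= mulr1.
rewrite -scalerAr gdeltaM !ffunE; case: eqP => [tE|_]; last by rewrite scaler0.
by rewrite tE mulKg eqxx in nh.
Qed.

Lemma gdeltaMr (g t : gT) (u : A) : (u * 'd g) t = u (t * g^-1)%g.
Proof.
rewrite [u in LHS]deltaE mulr_suml sum_ffunE (bigD1 (t * g^-1)%g) //= big1 => [|h nh].
  by rewrite -scalerAl gdeltaM !ffunE mulgKV eqxx addr0 /GRing.scale /= mulr1.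
rewrite -scalerAl gdeltaM !ffunE; case: eqP => [tE|_]; last by rewrite scaler0.
by rewrite tE mulgK eqxx in nh.
Qed.

Lemma galgME (u v : A) (t : gT) : (u * v) t = \sum_(h : gT) u h * v (h^-1 * t)%g.
Proof.
rewrite [u in LHS]deltaE mulr_suml sum_ffunE; apply: eq_bigr => h _.
by rewrite -scalerAl ffunE gdeltaMl.
Qed.

(** Left multiplication by [u] in the basis of group elements. *)
Definition regmx (u : A) : 'M[F]_#|gT| :=
  \matrix_(i, j) u (enum_val i * (enum_val j)^-1)%g.

Lemma regmxM u v : regmx (u * v) = regmx u *m regmx v.
Proof.
apply/matrixP=> i j; rewrite !mxE galgME.
rewrite (reindex (fun k : 'I_#|gT| => enum_val i * (enum_val k)^-1)%g) /=.
  by apply: eq_bigr => k _; rewrite !mxE invMg invgK -mulgA mulKg.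
exists (fun h => enum_rank (h^-1 * enum_val i)%g) => [k _|h _].
  by rewrite invMg invgK mulgKV enum_valK.
by rewrite enum_rankK invMg invgK mulKVg.
Qed.

Lemma mxtrace_regmx u : \tr (regmx u) = #|gT|%:R * u 1%g.
Proof.
rewrite /mxtrace; under eq_bigr do rewrite mxE mulgV.
by rewrite sumr_const card_ord mulr_natl.
Qed.

Hypothesis charF : [pchar F] =i pred0.

Lemma card_gT_neq0 : #|gT|%:R != 0 :> F.
Proof. by rewrite ((pcharf0P F).1 charF) -lt0n; apply/card_gt0P; exists 1%g. Qed.

(** The diagonal entries of [regmx u] all equal the coefficient of [u] at 1, so its zero trace is
    that coefficient times the invertible order of the group. *)
Lemma galg_sqr0 (u : A) : u * u = 0 -> u 1%g = 0.
Proof.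
move=> uu0; have /mxtrace_sqr0/eqP : regmx u *m regmx u = 0.
  by rewrite -regmxM uu0; apply/matrixP=> i j; rewrite !mxE ffunE.
by rewrite mxtrace_regmx mulf_eq0 (negPf card_gT_neq0) => /eqP.
Qed.

Definition conjsum (c : A) : A := \sum_(g : gT) 'd g * c * 'd g^-1%g.

Lemma conjsumE c (t : gT) : conjsum c t = \sum_(g : gT) c (t ^ g)%g.
Proof.
rewrite sum_ffunE; apply: eq_bigr => g _.
by rewrite gdeltaMr gdeltaMl invgK.
Qed.

Lemma conjsumJ c (t h : gT) : conjsum c (t ^ h)%g = conjsum c t.
Proof.
rewrite !conjsumE (reindex_inj (mulgI h^-1%g)) /=.
by apply: eq_bigr => g _; rewrite -conjgM mulKVg.
Qed.

(** * Idempotents from a family indexed by conjugacy classes *)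

Section Family.
Variables (I : finType) (c : I -> A) (rep : I -> gT).
Hypothesis c1 : forall i, c i 1%g != 0.
Hypothesis c_orth : forall i j a, i != j -> c i * a * c j = 0.
Hypothesis c_corner : forall i a, exists k, c i * a * c i = k *: c i.
Hypothesis rep_onto : forall g, exists i h, g = (rep i ^ h)%g.

(** If the factor were 0, [c i] would have square zero and [galg_sqr0] would contradict [c1]. The
    sigma type makes the factor available to [nidem]. *)
Lemma c_sqr i : {k | c i * c i = k *: c i & k != 0}.
Proof.
have ex : exists k, c i * c i == k *: c i.
  by have [k] := c_corner i 1; rewrite mulr1 => ->; exists k.
exists (xchoose ex); first exact/eqP/(xchooseP ex).
apply/eqP => k0; have /eqP := xchooseP ex; rewrite k0 scale0r => /galg_sqr0/eqP.
by rewrite (negPf (c1 i)).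
Qed.

Definition nidem i : A := (s2val (c_sqr i))^-1 *: c i.

Lemma conjsum_orth i j : i != j -> conjsum (c i) * conjsum (c j) = 0.
Proof.
move=> nij; rewrite mulr_suml big1 // => g _; rewrite mulr_sumr big1 // => h _.
by rewrite !mulrA -3!(mulrA 'd g) -(mulrA (c i)) c_orth // mulr0 mul0r.
Qed.

(** The coefficient of [conjsum (c i)] at 1 is the group order times that of [c i], hence nonzero,
    so [galg_sqr0] excludes a zero square. *)
Lemma conjsum_sqr i : conjsum (c i) * conjsum (c i) != 0.
Proof.
apply/eqP => /galg_sqr0/eqP; rewrite conjsumE.
under eq_bigr do rewrite conj1g.
by rewrite sumr_const -mulr_natl mulf_eq0 (negPf (c1 i)) orbF; apply/negP/card_gT_neq0.
Qed.

Lemma class_fun_ext (u v : A) :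
  (forall t h, u (t ^ h)%g = u t) -> (forall t h, v (t ^ h)%g = v t) ->
  (forall i, u (rep i) = v (rep i)) -> u = v.
Proof.
move=> uJ vJ uv; apply/ffunP=> g; have [i [h ->]] := rep_onto g.
by rewrite uJ vJ uv.
Qed.

Lemma sum_conjsumJ (a : I -> F) t h :
  (\sum_i a i *: conjsum (c i)) (t ^ h)%g = (\sum_i a i *: conjsum (c i)) t.
Proof. by rewrite !sum_ffunE; apply: eq_bigr => i _; rewrite !ffunE conjsumJ. Qed.

(** A class function vanishing at all representatives is zero; multiplying the combination by
    [conjsum (c i)] then isolates [a i]. *)
Lemma conjsum_free (a : I -> F) :
  (forall j, (\sum_i a i *: conjsum (c i)) (rep j) = 0) -> forall i, a i = 0.
Proof.
move=> a0 i; have u0 : \sum_i a i *: conjsum (c i) = 0.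
  apply: class_fun_ext => [t h|t h|j]; first exact: sum_conjsumJ.
    by rewrite !ffunE.
  by rewrite a0 ffunE.
have := congr1 ( *%R^~ (conjsum (c i))) u0; rewrite /= mul0r mulr_suml (bigD1 i) //=.
rewrite big1 => [|j nji]; last by rewrite -scalerAl conjsum_orth ?scaler0.
by rewrite addr0 -scalerAl => /eqP; rewrite scaler_eq0 (negPf (conjsum_sqr i)) orbF => /eqP.
Qed.

(** An analogue of a character table. It is square because the same type indexes the functions and
    the class representatives, so linear independence makes it invertible. *)
Definition classmx : 'M[F]_#|I| :=
  \matrix_(i, j) conjsum (c (enum_val i)) (rep (enum_val j)).

Lemma mul_classmx (v : 'rV[F]_#|I|) j :
  (v *m classmx) 0 (enum_rank j) =
  (\sum_i v 0 (enum_rank i) *: conjsum (c i)) (rep j).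
Proof.
rewrite mxE sum_ffunE (reindex (@enum_rank I)) /=; last first.
  by exists enum_val => i _; rewrite ?enum_rankK ?enum_valK.
by apply: eq_bigr => i _; rewrite mxE ffunE !enum_rankK.
Qed.

Lemma classmx_unit : classmx \in unitmx.
Proof.
rewrite -row_free_unit -kermx_eq0; apply/rowV0P => v /sub_kermxP vM0.
apply/rowP=> i; rewrite mxE -[i]enum_valK.
apply: (conjsum_free (a := fun i => v 0 (enum_rank i))) => j.
by rewrite -mul_classmx vM0 mxE.
Qed.

Lemma ideal_conjsum1 : ideal nidem 1.
Proof.
(* The row [w] is solved for so that the combination of the [conjsum (c i)] agrees with the unit at
   each representative; both being class functions, they are equal. *)
pose w := (\row_j (rep (enum_val j) == 1%g)%:R) *m invmx classmx.
have <- : \sum_i w 0 (enum_rank i) *: conjsum (c i) = 1.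
  apply: class_fun_ext => [t h|t h|j]; first exact: sum_conjsumJ.
    rewrite -gdelta1 !ffunE; congr (_ %:R); congr nat_of_bool.
    by apply/eqP/eqP => [/(congr1 (conjg^~ h^-1%g))|->];
       rewrite ?conjgK conj1g.
  by rewrite -mul_classmx mulmxKV ?classmx_unit // mxE enum_rankK -gdelta1 !ffunE.
apply: ideal_sum => i _; apply: idealZ; rewrite /conjsum; apply: ideal_sum => g _.
have -> : c i = s2val (c_sqr i) *: nidem i.
  by rewrite /nidem scalerA mulfV ?scale1r //; case: (c_sqr i).
by rewrite -scalerAr -scalerAl; apply/idealZ/ideal_gen.
Qed.

Lemma split_nidem : split_family nidem.
Proof.
have k0 i : s2val (c_sqr i) != 0 by case: (c_sqr i).
split=> [i|i|i a|i j a nij|]; last exact: ideal_conjsum1.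
- rewrite scaler_eq0 invr_eq0 (negPf (k0 i)) /=; apply/eqP => ci0.
  by move: (c1 i); rewrite ci0 ffunE eqxx.
- rewrite -scalerAl -scalerAr /nidem; move: (k0 i); case: (c_sqr i) => k /= -> _ k0i.
  by rewrite !scalerA mulfVK.
- have [k ek] := c_corner i a; exists ((s2val (c_sqr i))^-1 * k).
  by rewrite -scalerAl -!scalerAr -scalerAl ek /nidem !scalerA mulrAC.
by rewrite -!scalerAl -scalerAr c_orth // !scaler0.
Qed.

End Family.
End GroupAlg.

(** * Cycle types *)

Section CycleType.
Variable r : nat.
Implicit Types s t : 'S_r.

(** Fixed points count as cycles of length 1, and the cycles are sorted by decreasing length, so
    that [cycle_type] is a partition of [r]. *)
Definition cycles s : seq (seq 'I_r) :=
  sort (relpre size geq) [seq fingraph.orbit s x | x <- enum (froots s)].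

Definition cycle_type s : seq nat := shape (cycles s).

Lemma cycles_fcycle s : all (fcycle s) (cycles s).
Proof.
apply/allP => o; rewrite mem_sort => /mapP[x _ ->].
exact/cycle_orbit/perm_inj.
Qed.

Lemma cycles_uniq s o : o \in cycles s -> uniq o.
Proof. by rewrite mem_sort => /mapP[x _ ->]; apply: orbit_uniq. Qed.

(** A point common to the orbits of two roots would connect them, and connected roots are equal. *)
Lemma uniq_orbits s (l : seq 'I_r) :
  uniq l -> {subset l <= froots s} -> uniq (flatten [seq fingraph.orbit s x | x <- l]).
Proof.
elim: l => //= x l IHl /andP[xl ul] lroots; rewrite cat_uniq orbit_uniq /=.
rewrite IHl // ?andbT => [|y ly]; last by apply: lroots; rewrite inE ly orbT.
apply/hasPn => z /flatten_mapP[y ly]; rewrite -!fconnect_orbit => syz.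
have connS := fconnect_sym (@perm_inj _ s).
apply/negP => /= zx; have sxz : fconnect s x z by move: zx.
case/negP: xl; have /eqP ex : froots s x by apply: lroots; rewrite inE eqxx.
have /eqP ey : froots s y by apply: lroots; rewrite inE ly orbT.
suff -> : x = y by [].
rewrite -ex -ey; by apply/(fingraph.rootP connS)/(connect_trans sxz); rewrite connS.
Qed.

Lemma cycles_enum s : perm_eq (flatten (cycles s)) (enum 'I_r).
Proof.
have connS := fconnect_sym (@perm_inj _ s).
apply: (@perm_trans _ (flatten [seq fingraph.orbit s x | x <- enum (froots s)])).
  by apply: perm_flatten; rewrite perm_sort.
apply: uniq_perm; rewrite ?enum_uniq ?uniq_orbits ?enum_uniq //.
  by move=> x; rewrite mem_enum.
move=> y; rewrite mem_enum; apply/flatten_mapP.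
exists (froot s y); first by rewrite mem_enum; apply: roots_root.
by rewrite -fconnect_orbit connS; apply: connect_root.
Qed.

Lemma sumn_cycle_type s : sumn (cycle_type s) = r.
Proof. by rewrite -size_flatten (perm_size (cycles_enum s)) size_enum_ord. Qed.

Lemma cycle_type_gt0 s : all (leq 1) (cycle_type s).
Proof.
rewrite all_map; apply/allP => o; rewrite mem_sort => /mapP[x _ ->] /=.
by have := in_orbit s x; case: (fingraph.orbit s x).
Qed.

Lemma sorted_cycle_type s : sorted geq (cycle_type s).
Proof.
rewrite sorted_map; apply: sort_sorted => o o' /=; exact: leq_total.
Qed.

Lemma fcycle_next s o x : fcycle s o -> x \in o -> s x = next o x.
Proof. by move=> so xo; apply/eqP/(next_cycle so). Qed.

(** Write the cycles of [s] and of [t] one after the other and match the two lists position by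
    position. As the shapes agree, cycles go to cycles, so this matching conjugates [s] to [t]. *)
Lemma cycle_type_conj s t : cycle_type s = cycle_type t -> exists h, t = (s ^ h)%g.
Proof.
move=> st; set u := flatten (cycles s); set v := flatten (cycles t).
have uu : uniq u by rewrite (perm_uniq (cycles_enum s)) enum_uniq.
have uv : uniq v by rewrite (perm_uniq (cycles_enum t)) enum_uniq.
have mu x : x \in u by rewrite (perm_mem (cycles_enum s)) mem_enum.
have su : size u = size v by rewrite !size_flatten -/(cycle_type s) st.
pose h x := nth x v (index x u).
have vx x : (index x u < size v)%N by rewrite -su index_mem.
have h_inj : injective h.
  move=> x y; rewrite /h (set_nth_default x y) // => /eqP.
  by rewrite nth_uniq // => /eqP/(congr1 (nth x u)); rewrite !nth_index.
have hu : map h u = v.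
  case eu : u => [|x0 u0]; first by move: su; rewrite eu; case: (v).
  rewrite -eu; apply: (@eq_from_nth _ x0); first by rewrite size_map.
  move=> i; rewrite size_map => iu; rewrite (nth_map x0) // /h index_uniq //.
  by apply: set_nth_default; rewrite -su.
have hcycles : map (map h) (cycles s) = cycles t.
  apply: eq_from_flatten_shape; first by rewrite -map_flatten.
  rewrite [RHS](esym st) /cycle_type /shape -map_comp.
  by apply: eq_map => o /=; rewrite size_map.
have hs x : h (s x) = t (h x).
  have /flattenP[o os xo] := mu x.
  rewrite (fcycle_next (allP (cycles_fcycle s) o os) xo) -next_map ?(cycles_uniq os) //.
  have ot : map h o \in cycles t by rewrite -hcycles map_f.
  by rewrite (fcycle_next (allP (cycles_fcycle t) _ ot)) ?map_f.
exists (perm h_inj); apply/permP => y; rewrite -[y](permKV (perm h_inj)) permJ.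
by rewrite !(permE h_inj) hs.
Qed.

End CycleType.

(** * Tableaux *)

(* A bijective filling of a Young diagram, seen as the maps sending an entry to
   its row and its column; only the fact that columns have no holes is needed. *)
Record tableau r := Tableau {
  row : 'I_r -> nat;
  col : 'I_r -> 'I_r;
  cell_inj : forall i j, row i = row j -> col i = col j -> i = j;
  col_closed : forall i k, (k < row i)%N -> exists2 j, row j = k & col j = col i
}.

Section Dominance.
Variable r : nat.
Implicit Types (T U : tableau r) (k : nat) (c : 'I_r).

(** If the column reaches row [k] or beyond, having no holes it meets each of the first [k] rows;
    otherwise it lies entirely in them. *)
Lemma col_count T k c :
  (minn k #|[set i | col T i == c]| <= #|[set i | (row T i < k)%N && (col T i == c)]|)%N.
Proof.
case: (boolP [exists i, (col T i == c) && (k <= row T i)%N]).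
  case/existsP=> i /andP[/eqP ic ki]; rewrite geq_min; apply/orP; left.
  have /fin_all_exists[f fP] (m : 'I_k) : exists j, row T j = m /\ col T j = c.
    have [j] := col_closed (leq_trans (ltn_ord m) ki).
    by rewrite ic; exists j.
  rewrite -[X in (X <= _)%N]card_ord -(card_imset _ (f := f)) => [|m m' eqf].
    apply/subset_leq_card/subsetP => _ /imsetP[m _ ->]; rewrite inE.
    by have [-> ->] := fP m; rewrite ltn_ord eqxx.
  by apply: val_inj; rewrite /= -(fP m).1 -(fP m').1 eqf.
rewrite negb_exists => /forallP nk; rewrite geq_min; apply/orP; right.
apply/subset_leq_card/subsetP => i; rewrite !inE => /eqP ic.
by have := nk i; rewrite ic eqxx /= -ltnNge => ->.
Qed.

Section Pair.
Variables (T U : tableau r) (g : 'S_r).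
Hypothesis TU_inj : forall i j, row T i = row T j -> col U (g i) = col U (g j) -> i = j.

(** The entries counted on the left lie in distinct rows among the first [k], and [g] embeds them
    into column [c] of [U]; so their number is at most both terms of the minimum in [col_count]. *)
Lemma cell_count_le k c :
  (#|[set i | (row T i < k)%N && (col U (g i) == c)]| <=
   #|[set i | (row U i < k)%N && (col U i == c)]|)%N.
Proof.
apply: leq_trans (col_count _ _ _); rewrite leq_min; apply/andP; split.
  rewrite cardE -(size_map (row T)) -[X in (_ <= X)%N](size_iota 0).
  apply: uniq_leq_size => [|m /mapP[i]]; last first.
    by rewrite mem_enum mem_iota inE => /andP[ik _] ->.
  rewrite map_inj_in_uniq ?enum_uniq // => i j.
  by rewrite !mem_enum !inE => /andP[_ /eqP ic] /andP[_ /eqP jc] /TU_inj; rewrite ic jc; apply.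
rewrite -(card_imset _ (@perm_inj _ g)); apply/subset_leq_card/subsetP=> _ /imsetP[i + ->].
by rewrite !inE => /andP[].
Qed.

Lemma card_row_sum (V : tableau r) (f : 'I_r -> 'I_r) k :
  #|[set i | (row V i < k)%N]| = (\sum_c #|[set i | (row V i < k)%N && (f i == c)]|)%N.
Proof.
rewrite -sum1_card (partition_big f predT) //=; apply: eq_bigr => c _.
by rewrite -sum1_card; apply: eq_bigl => i; rewrite !inE.
Qed.

Lemma dominance_le k :
  (#|[set i | (row T i < k)%N]| <= #|[set i | (row U i < k)%N]|)%N.
Proof.
rewrite (card_row_sum T (fun i => col U (g i))) (card_row_sum U (col U)).
by apply: leq_sum => c _; apply: cell_count_le.
Qed.

Hypothesis TU_shape : forall k, #|[set i | (row T i < k)%N]| = #|[set i | (row U i < k)%N]|.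

(** Equal shapes make the sums over all columns equal, which forces equality in each inequality
    [cell_count_le]. *)
Lemma cell_count_eq k c :
  #|[set i | (row T i < k)%N && (col U (g i) == c)]| =
  #|[set i | (row U i < k)%N && (col U i == c)]|.
Proof.
have := leqif_sum (fun c' (_ : xpredT c') => leqif_eq (cell_count_le k c')).
rewrite -(card_row_sum T (fun i => col U (g i))) -(card_row_sum U (col U)).
by case=> _; rewrite TU_shape eqxx => /esym/forallP/(_ c)/eqP.
Qed.

(** Passing from the first [row T i] rows to one more strictly increases the count for the column of
    [g i] in [T], hence also in [U], so that column of [U] has a cell in this row. *)
Lemma cell_exists i : exists2 j, row U j = row T i & col U j = col U (g i).
Proof.
pose X k := [set j | (row T j < k)%N && (col U (g j) == col U (g i))].
pose Y k := [set j | (row U j < k)%N && (col U j == col U (g i))].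
have XY : (#|Y (row T i)| < #|Y (row T i).+1|)%N.
  rewrite -!cell_count_eq; apply: proper_card; apply/properP; split.
    by apply/subsetP=> j; rewrite !inE => /andP[/ltnW jk ->]; rewrite ltnS jk.
  by exists i; rewrite !inE ?ltnS ?leqnn ?ltnn ?eqxx.
have /subsetPn[j] : ~~ (Y (row T i).+1 \subset Y (row T i)).
  by apply/negP => /subset_leq_card; rewrite leqNgt XY.
rewrite !inE => /andP[jk /eqP jc]; rewrite jc eqxx andbT -leqNgt => kj.
by exists j => //; apply/eqP; rewrite eqn_leq kj -ltnS jk.
Qed.

End Pair.

End Dominance.

(** * Young symmetrizers *)

Section Young.
Variables (F : fieldType) (r : nat).
Hypothesis charF : [pchar F] =i pred0.
Local Notation A := (catalg F (groupcat 'S_r)).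
Local Notation "''d' g" := (delta F (g : groupcat 'S_r)) (at level 8, g at level 2).

Definition stab (T : eqType) (f : 'I_r -> T) : {set 'S_r} :=
  [set s : 'S_r | [forall i, f (s i) == f i]].

Lemma stabP (T : eqType) (f : 'I_r -> T) (s : 'S_r) :
  reflect (forall i, f (s i) = f i) (s \in stab f).
Proof. by rewrite inE; apply/eqfunP. Qed.

Lemma stabMl (T : eqType) (f : 'I_r -> T) (p s : 'S_r) :
  p \in stab f -> ((p * s)%g \in stab f) = (s \in stab f).
Proof.
move/stabP=> pf; apply/stabP/stabP => sf i; last by rewrite permM sf pf.
by rewrite -[i](permKV p) -permM sf pf.
Qed.

Lemma stabMr (T : eqType) (f : 'I_r -> T) (p s : 'S_r) :
  p \in stab f -> ((s * p)%g \in stab f) = (s \in stab f).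
Proof. by move/stabP=> pf; apply/stabP/stabP => sf i; have := sf i; rewrite permM pf. Qed.

Lemma stab_tperm (T : eqType) (f : 'I_r -> T) i j : f i = f j -> tperm i j \in stab f.
Proof. by move=> fij; apply/stabP=> k; case: tpermP => // ->. Qed.

(** The flag selects the sign character ([true]) or the trivial one ([false]), so that row
    symmetrizers and column antisymmetrizers share their lemmas. *)
Definition sgn (b : bool) (s : 'S_r) : F := (-1) ^+ (b && odd_perm s).

Lemma sgnM b s t : sgn b (s * t) = sgn b s * sgn b t.
Proof. by rewrite /sgn odd_permM; case: b => //=; rewrite ?signr_addb ?mulr1. Qed.

Lemma sgn_sqr b s : sgn b s * sgn b s = 1.
Proof. by rewrite /sgn -expr2 sqrr_sign. Qed.

Definition symz (T : eqType) (b : bool) (f : 'I_r -> T) : A :=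
  \sum_(s in stab f) sgn b s *: 'd s.

Lemma symzE (T : eqType) b (f : 'I_r -> T) (s : 'S_r) :
  symz b f s = if s \in stab f then sgn b s else 0.
Proof.
rewrite sum_ffunE; case: ifPn => sf.
  rewrite (bigD1 s) //= big1 => [|t /andP[_ nts]].
    by rewrite !ffunE eqxx addr0 /GRing.scale /= mulr1.
  by rewrite !ffunE eq_sym (negPf nts) scaler0.
rewrite big1 // => t tf; rewrite !ffunE; case: eqP => [st|_]; last by rewrite scaler0.
by rewrite st tf in sf.
Qed.

Lemma symzMl (T : eqType) b (f : 'I_r -> T) (p : 'S_r) :
  p \in stab f -> 'd p * symz b f = sgn b p *: symz b f.
Proof.
move=> pf; rewrite mulr_sumr [in RHS]/symz [in RHS](reindex_inj (mulgI p)) scaler_sumr.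
apply: eq_big => [s|s sf]; first by rewrite stabMl.
by rewrite -scalerAr gdeltaM scalerA sgnM mulrA sgn_sqr mul1r.
Qed.

Lemma symzMr (T : eqType) b (f : 'I_r -> T) (p : 'S_r) :
  p \in stab f -> symz b f * 'd p = sgn b p *: symz b f.
Proof.
move=> pf; rewrite mulr_suml [in RHS]/symz [in RHS](reindex_inj (mulIg p)) scaler_sumr.
apply: eq_big => [s|s sf]; first by rewrite stabMr.
by rewrite -scalerAl gdeltaM scalerA sgnM mulrCA sgn_sqr mulr1.
Qed.

(** The transposition of [i] and [j] is absorbed by the left factor, and its conjugate by [g] is
    absorbed by the right one. The two absorptions have opposite signs, so twice the product
    vanishes. *)
Lemma symz_vanish (T U : eqType) b (f : 'I_r -> T) (h : 'I_r -> U) (g : 'S_r) i j :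
  i != j -> f i = f j -> h (g i) = h (g j) -> symz b f * 'd g * symz (~~ b) h = 0.
Proof.
move=> nij fij hij; set X := LHS.
have tf := stab_tperm fij; have th := stab_tperm hij.
have odd_t k l : k != l -> sgn b (tperm k l) = - sgn (~~ b) (tperm k l).
  by move=> nkl; rewrite /sgn odd_tperm nkl; case: (b); rewrite /= ?opprK.
have ngij : g i != g j by rewrite (inj_eq perm_inj).
have eqX : sgn b (tperm i j) *: X = sgn (~~ b) (tperm i j) *: X.
  have -> : sgn (~~ b) (tperm i j) = sgn (~~ b) (tperm (g i) (g j)).
    by rewrite /sgn !odd_tperm nij ngij.
  rewrite /X 2!scalerAl -symzMr // scalerAr -symzMl // !mulrA.
  by rewrite -!(mulrA (symz b f)) !gdeltaM -tpermJ conjgE mulKVg.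
have : (sgn b (tperm i j) * 2) *: X = 0.
  by rewrite mulr_natr mulr2n scalerDl {1}eqX odd_t // -scalerDl addrN scale0r.
move/eqP; rewrite scaler_eq0 mulf_eq0 ((pcharf0P F).1 charF) orbF signr_eq0.
by move/eqP.
Qed.

Section Symmetrizer.
Variable T : tableau r.

Definition young : A := symz false (row T) * symz true (col T).

Lemma stab_row_col s : s \in stab (row T) -> s \in stab (col T) -> s = 1%g.
Proof.
move=> /stabP sr /stabP sc; apply/permP=> i; rewrite perm1.
exact: (@cell_inj _ T).
Qed.

Lemma stabV (U : eqType) (f : 'I_r -> U) (s : 'S_r) : (s^-1%g \in stab f) = (s \in stab f).
Proof.
apply/stabP/stabP => sf i; first by rewrite -{2}(permK s i) sf.
by rewrite -{2}(permKV s i) sf.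
Qed.

(** Only the identity preserves both rows and columns, so a single term contributes to this
    coefficient. *)
Lemma young1 : young 1%g = 1.
Proof.
rewrite galgME (bigD1 1%g) //= big1 => [|p np].
  rewrite mulg1 invg1 !symzE !ifT ?addr0; try by apply/stabP=> i; rewrite perm1.
  by rewrite /sgn odd_perm1 andbF mulr1.
rewrite mulg1 !symzE stabV; case: ifP => pr; last by rewrite mul0r.
case: ifP => pc; last by rewrite mulr0.
by rewrite (stab_row_col pr pc) eqxx in np.
Qed.

End Symmetrizer.

Lemma galg_ind (P : A -> Prop) :
  (forall g, P ('d g)) -> P 0 -> (forall u v, P u -> P v -> P (u + v)) ->
  (forall k u, P u -> P (k *: u)) -> forall u, P u.
Proof.
move=> Pd P0 PD PZ u; rewrite (deltaE u).
by elim/big_rec: _ => // g v _ Pv; apply: PD => //; apply: PZ.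
Qed.

(** By linearity [u] is a permutation [g]. Either [g] sends two entries of a row into one column and
    the product vanishes, or [g] splits into a row and a column permutation, which are absorbed up
    to sign. *)
Lemma symz_row_col (T : tableau r) u :
  exists k, symz false (row T) * u * symz true (col T) = k *: young T.
Proof.
elim/galg_ind: u => [g||u v [k ku] [l lv]|k u [l lu]].
- case: (boolP [forall i, forall j,
    (row T i == row T j) && (col T (g i) == col T (g j)) ==> (i == j)]).
    move=> /forallP ginj.
    have TT i j : row T i = row T j -> col T (g i) = col T (g j) -> i = j.
      by move=> rij cij; have /forallP/(_ j) := ginj i; rewrite rij cij !eqxx => /eqP.
    (* The row factor [p] sends [i] to the entry in the row of [i] and the column of [g i]; the
       remaining factor then preserves columns. *)
    have /fin_all_exists[p pP] i : exists j, row T j = row T i /\ col T j = col T (g i).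
      by have [j] := cell_exists TT (fun k => erefl) i; exists j.
    have p_inj : injective p.
      by move=> i j pij; apply: TT; rewrite -?(pP i).1 -?(pP j).1 -?(pP i).2 -?(pP j).2 pij.
    have pr : perm p_inj \in stab (row T) by apply/stabP=> i; rewrite permE (pP i).1.
    have qc : ((perm p_inj)^-1 * g)%g \in stab (col T).
      apply/stabP=> i; rewrite permM -{2}(permKV (perm p_inj) i).
      by rewrite [in RHS]permE (pP _).2.
    exists (sgn true ((perm p_inj)^-1 * g)%g).
    rewrite -{1}[g](mulKVg (perm p_inj)) -gdeltaM mulrA symzMr // -!mulrA symzMl //.
    by rewrite /sgn /= scale1r -scalerAr.
  rewrite negb_forall => /existsP[i]; rewrite negb_forall => /existsP[j].
  rewrite negb_imply => /andP[/andP[/eqP rij /eqP cij] nij].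
  by exists 0; rewrite scale0r (symz_vanish _ nij rij cij).
- by exists 0; rewrite mulr0 mul0r scale0r.
- by exists (k + l); rewrite mulrDr mulrDl ku lv scalerDl.
by exists (k * l); rewrite -scalerAr -scalerAl lu scalerA.
Qed.

Lemma young_corner (T : tableau r) u : exists k, young T * u * young T = k *: young T.
Proof.
have [k ek] := symz_row_col T (symz true (col T) * u * symz false (row T)).
by exists k; rewrite -ek /young !mulrA.
Qed.

(** If an inequality fails, [dominance_le] shows that every [g] sends two entries of some row of [T]
    into one column of [U], and [symz_vanish] kills every term. *)
Lemma symz_rowcol_neq0 (T U : tableau r) b u :
  symz b (row T) * u * symz (~~ b) (col U) != 0 ->
  forall k, (#|[set i | (row T i < k)%N]| <= #|[set i | (row U i < k)%N]|)%N.
Proof.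
move=> nz k; rewrite leqNgt; apply/negP => lt_k; case/eqP: nz.
elim/galg_ind: u => [g||u v eu ev|l u eu].
- case: (boolP [forall i, forall j,
    (row T i == row T j) && (col U (g i) == col U (g j)) ==> (i == j)]).
    move=> /forallP ginj; move: lt_k; rewrite ltnNge (@dominance_le _ T U g) // => i j rij cij.
    by have /forallP/(_ j) := ginj i; rewrite rij cij !eqxx => /eqP.
  rewrite negb_forall => /existsP[i]; rewrite negb_forall => /existsP[j].
  rewrite negb_imply => /andP[/andP[/eqP rij /eqP cij] nij].
  by rewrite (symz_vanish _ nij rij cij).
- by rewrite mulr0 mul0r.
- by rewrite mulrDr mulrDl eu ev addr0.
by rewrite -scalerAr -scalerAl eu scaler0.
Qed.

(** With the column factor on the left, it is the inverse of [g] that carries rows of [T] to columns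
    of [U]. *)
Lemma symz_colrow_neq0 (T U : tableau r) b u :
  symz (~~ b) (col U) * u * symz b (row T) != 0 ->
  forall k, (#|[set i | (row T i < k)%N]| <= #|[set i | (row U i < k)%N]|)%N.
Proof.
move=> nz k; rewrite leqNgt; apply/negP => lt_k; case/eqP: nz.
elim/galg_ind: u => [g||u v eu ev|l u eu].
- case: (boolP [forall i, forall j,
    (row T i == row T j) && (col U (g^-1%g i) == col U (g^-1%g j)) ==> (i == j)]).
    move=> /forallP ginj; move: lt_k; rewrite ltnNge.
    rewrite (@dominance_le _ T U g^-1%g) // => i j rij cij.
    by have /forallP/(_ j) := ginj i; rewrite rij cij !eqxx => /eqP.
  rewrite negb_forall => /existsP[i]; rewrite negb_forall => /existsP[j].
  rewrite negb_imply => /andP[/andP[/eqP rij /eqP cij] nij].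
  have := @symz_vanish _ _ (~~ b) (col U) (row T) g (g^-1%g i) (g^-1%g j).
  by rewrite negbK; apply; rewrite ?permKV ?(inj_eq perm_inj).
- by rewrite mulr0 mul0r.
- by rewrite mulrDr mulrDl eu ev addr0.
by rewrite -scalerAr -scalerAl eu scaler0.
Qed.

(** The outer factors, rows of [T] and columns of [U], give one inequality; the inner ones, columns
    of [T] and rows of [U], give the other. *)
Lemma young_neq0 (T U : tableau r) u : young T * u * young U != 0 ->
  forall k, #|[set i | (row T i < k)%N]| = #|[set i | (row U i < k)%N]|.
Proof.
rewrite /young => nz k; apply/eqP; rewrite eqn_leq; apply/andP; split.
  apply: (@symz_rowcol_neq0 T U false (symz true (col T) * u * symz false (row U))).
  by rewrite /= !mulrA -!mulrA in nz *.
apply: (@symz_colrow_neq0 U T false u); apply: contraNneq nz => /= eq0.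
by rewrite !mulrA -(mulrA (symz false (row T))) -(mulrA (symz false (row T))) eq0 mulr0 mul0r.
Qed.

End Young.

(** * The standard tableau of a partition *)

Section PartitionTableau.
Variables (r : nat) (L : seq nat).
Hypotheses (sumL : sumn L = r) (sortL : sorted geq L).

(** The diagram is filled row by row: [reshape_index] finds the row of position [i], and
    [reshape_offset] its place in that row. *)
Definition rowL (i : 'I_r) : nat := reshape_index L i.

Lemma colL_subproof (i : 'I_r) : (reshape_offset L i < r)%N.
Proof. exact: leq_ltn_trans (leq_subr _ _) (ltn_ord i). Qed.

Definition colL (i : 'I_r) : 'I_r := Ordinal (colL_subproof i).

Lemma cellL_inj i j : rowL i = rowL j -> colL i = colL j -> i = j.
Proof.
move=> eqr /(congr1 val) /= eqc; apply: val_inj => /=.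
by rewrite -(reshape_indexK L i) -(reshape_indexK L j) -/(rowL i) eqr eqc.
Qed.

(** The offset of [i] is below the length of its own row, hence below that of the earlier row [k],
    since the row lengths decrease. *)
Lemma colL_closed i k : (k < rowL i)%N -> exists2 j, rowL j = k & colL j = colL i.
Proof.
move=> ki; have iL : (i < sumn L)%N by rewrite sumL.
have cL : (reshape_offset L i < nth 0 L k)%N.
  apply: leq_trans (reshape_offsetP iL) _.
  have geq_trans : transitive geq by move=> a b c; rewrite /= => ba ac; apply: leq_trans ba.
  have rL := reshape_indexP iL.
  apply: (sorted_leq_nth geq_trans (fun a => leqnn a) 0 sortL); rewrite ?inE //.
    exact: ltn_trans rL.
  exact: ltnW.
have jr : (flatten_index L k (reshape_offset L i) < r)%N.
  by rewrite -[X in (_ < X)%N]sumL flatten_indexP.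
exists (Ordinal jr); first by rewrite /rowL /= flatten_indexKl.
by apply: val_inj; rewrite /= flatten_indexKr.
Qed.

Definition tableauL : tableau r := Tableau cellL_inj colL_closed.

Lemma card_row_eq k : #|[set i | row tableauL i == k]| = nth 0 L k.
Proof.
have fP (c : 'I_(nth 0 L k)) : (flatten_index L k c < r)%N.
  by rewrite -[X in (_ < X)%N]sumL flatten_indexP.
rewrite -[RHS]card_ord -(card_imset _ (f := fun c => Ordinal (fP c))) => [|c c' [] /addnI eqc].
  apply: eq_card => i; rewrite !inE; apply/eqP/imsetP => [ik|[c _ ->]]; last first.
    by rewrite /= /rowL /= flatten_indexKl.
  have iL : (i < sumn L)%N by rewrite sumL.
  have := reshape_offsetP iL; rewrite -/(rowL i) [rowL i]ik => ci.
  exists (Ordinal ci) => //; apply: val_inj.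
  by rewrite /= -ik /= reshape_indexK.
exact: val_inj.
Qed.

End PartitionTableau.

(** Successive differences of the counts are the parts; as all parts are positive, neither list can
    outlast the other. *)
Lemma tableauL_shape_inj r L M (sumL : sumn L = r) (sortL : sorted geq L)
    (sumM : sumn M = r) (sortM : sorted geq M) :
  all (leq 1) L -> all (leq 1) M ->
  (forall k, #|[set i | (row (tableauL sumL sortL) i < k)%N]| =
             #|[set i | (row (tableauL sumM sortM) i < k)%N]|) -> L = M.
Proof.
move=> L_gt0 M_gt0 eqLM.
have split_card (T : tableau r) k : #|[set i | (row T i < k.+1)%N]| =
    (#|[set i | (row T i < k)%N]| + #|[set i | row T i == k]|)%N.
  rewrite -cardsUI [X in (_ + X)%N](_ : _ = 0%N) ?addn0; last first.
    by apply/eqP; rewrite cards_eq0; apply/eqP/setP=> i; rewrite !inE; case: ltngtP.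
  by apply: eq_card => i; rewrite !inE ltnS leq_eqVlt orbC.
have eq_nth k : nth 0%N L k = nth 0%N M k.
  rewrite -(card_row_eq sumL sortL) -(card_row_eq sumM sortM).
  by apply/(@addnI #|[set i | (row (tableauL sumL sortL) i < k)%N]|);
     rewrite {2}eqLM -!split_card.
have szle (N N' : seq nat) : all (leq 1) N -> (forall k, nth 0 N k = nth 0 N' k)%N ->
    (size N <= size N')%N.
  move=> N_gt0 eqN; rewrite leqNgt; apply/negP => lt_sz.
  have := all_nthP 0%N N_gt0 _ lt_sz.
  by rewrite eqN nth_default.
apply: (@eq_from_nth _ 0%N) => [|k _]; last exact: eq_nth.
by apply/eqP; rewrite eqn_leq !szle.
Qed.

(** * Splitting the group algebra of a symmetric group *)

Section SymSplit.
Variables (F : fieldType) (r : nat).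
Hypothesis charF : [pchar F] =i pred0.

Definition canon (s : 'S_r) : 'S_r := choose (fun t => cycle_type t == cycle_type s) s.

Lemma cycle_type_canon s : cycle_type (canon s) = cycle_type s.
Proof. exact/eqP/(@chooseP _ (fun t => cycle_type t == cycle_type s)). Qed.

Lemma eq_canon s t : cycle_type s = cycle_type t -> canon s = canon t.
Proof.
move=> st; rewrite /canon -st; apply: choose_id => //.
by rewrite st.
Qed.

(** One chosen permutation for each cycle type. This type indexes both the conjugacy classes and the
    Young symmetrizers, which makes the two equally numerous by construction. *)
Definition ytype := {s : 'S_r | canon s == s}.

Lemma ytype_inj (i j : ytype) : cycle_type (val i) = cycle_type (val j) -> i = j.
Proof.
move=> /eq_canon; rewrite (eqP (valP i)) (eqP (valP j)); exact: val_inj.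
Qed.

Definition ytableau (i : ytype) : tableau r :=
  tableauL (sumn_cycle_type (val i)) (sorted_cycle_type (val i)).

Lemma sym_split : {e : ytype -> catalg F (groupcat 'S_r) | split_family e}.
Proof.
pose c i := young F (ytableau i).
have c1 i : c i 1%g != 0 by rewrite /c young1 oner_eq0.
have c_orth i j a : i != j -> c i * a * c j = 0.
  move=> nij; apply/eqP/negPn/negP => /(young_neq0 charF) shp; case/eqP: nij.
  by apply/ytype_inj/(tableauL_shape_inj _ _ shp); apply: cycle_type_gt0.
have c_corner i a := young_corner charF (ytableau i) a.
have rep_onto g : exists i h, g = (val (i : ytype) ^ h)%g.
  have cg : canon (canon g) == canon g.
    by apply/eqP/eq_canon/cycle_type_canon.
  exists (exist _ (canon g) cg).
  by have [h gh] := cycle_type_conj (cycle_type_canon g); exists h.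
by exists (nidem charF c1 c_corner); apply: (split_nidem charF c1 c_orth c_corner rep_onto).
Qed.

End SymSplit.

(** * The groupoid of partial bijections *)

Section RookCat.
Variable n : nat.
Implicit Types (a b c d w : rook n) (S : {set 'I_n}).

Lemma rook_inj a i i' j : val a i = Some j -> val a i' = Some j -> i = i'.
Proof.
move=> ai ai'; have /forallP/(_ i)/forallP/(_ i') := valP a.
by rewrite ai ai' eqxx /= => /eqP.
Qed.

Definition pinj (f : 'I_n -> option 'I_n) :=
  forall i i' j, f i = Some j -> f i' = Some j -> i = i'.

Lemma pinjbP f : pinj f -> pinjb (finfun f).
Proof.
move=> fi; apply/forallP=> i; apply/forallP=> i'; rewrite !ffunE.
case fiE : (f i) => [j|] //=; apply/implyP => /eqP fi'.
by apply/eqP/(fi i i' j).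
Qed.

Definition mkrook f (fP : pinj f) : rook n := exist _ (finfun f) (pinjbP fP).

Lemma mkrookE f (fP : pinj f) i : val (mkrook fP) i = f i.
Proof. by rewrite /= ffunE. Qed.

Lemma rookP a b : (forall i, val a i = val b i) <-> a = b.
Proof. by split=> [ab|-> //]; apply/val_inj/ffunP. Qed.

Definition dom a := [set i | val a i != None].
Definition im a := [set j | [exists i, val a i == Some j]].

Lemma domP a i : reflect (exists j, val a i = Some j) (i \in dom a).
Proof.
rewrite inE; case: (val a i) => [j|]; constructor; first by exists j.
by case.
Qed.

Lemma notin_dom a i : i \notin dom a -> val a i = None.
Proof. by rewrite inE negbK => /eqP. Qed.

Lemma imP a j : reflect (exists i, val a i = Some j) (j \in im a).
Proof. by rewrite inE; apply/existsPP => i; apply/eqP. Qed.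

Lemma rcomp_pinj a b : pinj (fun i => obind (fun j => val b j) (val a i)).
Proof.
move=> i i' k; case ai: (val a i) => [j|] //=; case ai': (val a i') => [j'|] //=.
by move=> bj bj'; rewrite (rook_inj bj bj') in ai; apply: rook_inj ai'.
Qed.

Definition rcomp a b : rook n := mkrook (@rcomp_pinj a b).

Lemma rcompE a b i : val (rcomp a b) i = obind (fun j => val b j) (val a i).
Proof. exact: mkrookE. Qed.

Lemma rcompA a b c : rcomp a (rcomp b c) = rcomp (rcomp a b) c.
Proof.
apply/rookP => i; rewrite !rcompE; case: (val a i) => [j|] //=.
by rewrite rcompE.
Qed.

Lemma ridm_pinj S : pinj (fun i => if i \in S then Some i else None).
Proof. by move=> i i' j; case: ifP => // _ [->]; case: ifP => // _ [->]. Qed.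

Definition ridm S : rook n := mkrook (@ridm_pinj S).

Lemma ridmE S i : val (ridm S) i = if i \in S then Some i else None.
Proof. exact: mkrookE. Qed.

Lemma dom_ridm S : dom (ridm S) = S.
Proof. by apply/setP=> i; rewrite inE ridmE; case: ifP. Qed.

Lemma im_ridm S : im (ridm S) = S.
Proof.
apply/setP=> j; apply/imP/idP => [[i]|jS]; last by exists j; rewrite ridmE jS.
by rewrite ridmE; case: ifP => // iS [<-].
Qed.

Lemma dom_rcomp a b : im a = dom b -> dom (rcomp a b) = dom a.
Proof.
move=> ab; apply/setP=> i; rewrite [RHS]inE [LHS]inE rcompE.
case ai: (val a i) => [j|] //=; have : j \in dom b by rewrite -ab; apply/imP; exists i.
by rewrite inE.
Qed.

Lemma im_rcomp a b : im a = dom b -> im (rcomp a b) = im b.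
Proof.
move=> ab; apply/setP=> k; apply/imP/imP => [[i]|[j bj]].
  by rewrite rcompE; case: (val a i) => [j|] //= bj; exists j.
have : j \in im a by rewrite ab; apply/domP; exists k.
by case/imP=> i ai; exists i; rewrite rcompE ai.
Qed.

Lemma rcomp_ridl a : rcomp (ridm (dom a)) a = a.
Proof.
apply/rookP => i; rewrite rcompE ridmE; case: ifP => //= /negbT /notin_dom.
by [].
Qed.

Lemma rcomp_ridr a : rcomp a (ridm (im a)) = a.
Proof.
apply/rookP => i; rewrite rcompE; case ai: (val a i) => [j|] //=.
by rewrite ridmE ifT //; apply/imP; exists i.
Qed.

(** Unlike the always defined [rcomp], groupoid composition requires the image of the first map to
    be the domain of the second. *)
Definition pcomp a b := if im a == dom b then Some (rcomp a b) else None.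
Definition ridents := [set ridm S | S : {set 'I_n}].

Lemma pcompA a b c : obind (pcomp a) (pcomp b c) = obind (pcomp^~ c) (pcomp a b).
Proof.
rewrite /pcomp; case: eqP => bc; case: eqP => ab //=.
- by rewrite dom_rcomp // im_rcomp // ab bc !eqxx rcompA.
- by rewrite dom_rcomp //; case: eqP.
by rewrite im_rcomp //; case: eqP.
Qed.

Lemma ridm_ident S : ridm S \in ridents. Proof. exact: imset_f. Qed.

Lemma pcomp_idl e a : e \in ridents ->
  pcomp e a = if e == ridm (dom a) then Some a else None.
Proof.
case/imsetP=> S _ ->; rewrite /pcomp im_ridm.
case: eqP => [->|nS]; first by rewrite rcomp_ridl eqxx.
by case: eqP => // /(congr1 dom); rewrite !dom_ridm.
Qed.

Lemma pcomp_idr e a : e \in ridents ->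
  pcomp a e = if e == ridm (im a) then Some a else None.
Proof.
case/imsetP=> S _ ->; rewrite /pcomp dom_ridm.
case: eqP => [<-|nS]; first by rewrite rcomp_ridr eqxx.
by case: eqP => // /(congr1 dom); rewrite !dom_ridm => /esym.
Qed.

Lemma some_rident : exists e, e \in ridents.
Proof. by exists (ridm set0); apply: ridm_ident. Qed.

Definition rookcat : fincat :=
  @FinCat (rook n) pcomp ridents (fun a => ridm (dom a)) (fun a => ridm (im a)) pcompA
    (fun a => ridm_ident (dom a)) (fun a => ridm_ident (im a))
    pcomp_idl pcomp_idr some_rident.

Lemma rinv_pinj a : pinj (fun j => [pick i | val a i == Some j]).
Proof.
move=> j j' i; case: pickP => // i1 /eqP ai1 [<-]; case: pickP => // i2 /eqP ai2 [ii].
by move: ai1; rewrite -ii ai2 => -[].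
Qed.

Definition rinv a : rook n := mkrook (@rinv_pinj a).

Lemma rinvE a i j : val a i = Some j -> val (rinv a) j = Some i.
Proof.
move=> ai; rewrite mkrookE; case: pickP => [i' /eqP ai'|/(_ i)].
  by rewrite (rook_inj ai ai').
by rewrite ai eqxx.
Qed.

Lemma dom_rinv a : dom (rinv a) = im a.
Proof.
apply/setP=> j; apply/domP/imP => [[i]|[i ai]]; last by exists i; apply: rinvE.
by rewrite mkrookE; case: pickP => // i' /eqP ai _; exists i'.
Qed.

Lemma pcomp_rinv a : pcomp a (rinv a) = Some (ridm (dom a)).
Proof.
rewrite /pcomp dom_rinv eqxx; congr Some; apply/rookP => i; rewrite rcompE ridmE.
case: ifP => [/domP[j ai]|/negbT/notin_dom-> //].
by rewrite ai /= (rinvE ai).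
Qed.

Definition rle w a := [forall i, (val w i == None) || (val w i == val a i)].

Lemma rleP w a : reflect (w = rcomp (ridm (dom w)) a) (rle w a).
Proof.
apply: (iffP forallP) => [wa|-> i]; last first.
  by rewrite !rcompE ridmE; case: ifP => //= _; rewrite eqxx orbT.
apply/rookP => i; rewrite rcompE ridmE; case: ifP => [|/negbT/notin_dom //].
by rewrite inE; case/orP: (wa i) => [->|/eqP].
Qed.

Lemma rle_val w a i : rle w a -> i \in dom w -> val w i = val a i.
Proof. by move/forallP/(_ i); rewrite inE => /orP[->|/eqP]. Qed.

Lemma dom_rle w a : rle w a -> dom w \subset dom a.
Proof. by move=> wa; apply/subsetP=> i iw; have := iw; rewrite !inE (rle_val wa iw). Qed.

Lemma rle_restr S a : rle (rcomp (ridm S) a) a.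
Proof.
apply/forallP=> i; rewrite rcompE ridmE; case: ifP => //= _; rewrite ?eqxx ?orbT //.
Qed.

Lemma rle_rcomp a a' b b' : rle a' a -> rle b' b -> rle (rcomp a' b') (rcomp a b).
Proof.
move=> aa bb; apply/forallP=> i; rewrite !rcompE.
case ai: (val a' i) => [j|] //=; rewrite -(rle_val aa) ?ai /=; last by apply/domP; exists j.
by move/forallP: bb; apply.
Qed.

(** Restricting [a] to the domain of [w], and then [b] to the image obtained, factors [w] inside the
    groupoid. *)
Lemma rle_factor w a b (a0 := rcomp (ridm (dom w)) a) (b0 := rcomp (ridm (im a0)) b) :
  rle w (rcomp a b) -> pcomp a0 b0 = Some w.
Proof.
move=> wab; have w_dom i : i \in dom w -> exists j, val a i = Some j /\ val w i = val b j.
  move=> iw; move: (iw); rewrite inE (rle_val wab iw) rcompE.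
  by case: (val a i) => [j|] //= _; exists j.
have a0E i : val a0 i = if i \in dom w then val a i else None.
  by rewrite rcompE ridmE; case: ifP.
have domb0 : im a0 = dom b0.
  apply/setP=> j; rewrite [RHS]inE rcompE ridmE; case: ifP => // /imP[i].
  rewrite a0E; case: ifP => // iw; have [j' [-> wi]] := w_dom i iw => -[<-] /=.
  by rewrite -wi; move: iw; rewrite inE => ->.
rewrite /pcomp domb0 eqxx; congr Some; apply/rookP => i; rewrite rcompE a0E.
case: ifP => [iw|/negbT/notin_dom -> //].
have [j [ai ->]] := w_dom i iw; rewrite ai -[LHS]/(val b0 j) rcompE ridmE ifT //.
by apply/imP; exists i; rewrite a0E iw.
Qed.

Definition rook_fun a i := odflt i (val a i).

Lemma card_rook_fun a S : S \subset dom a -> #|rook_fun a @: S| = #|S|.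
Proof.
move=> /subsetP Sa; apply: card_in_imset => i i' /Sa/domP[j ai] /Sa/domP[j' ai'].
by rewrite /rook_fun ai ai' /= => jj; apply: (rook_inj ai); rewrite jj.
Qed.

Lemma rook_fun_dom a : rook_fun a @: dom a = im a.
Proof.
apply/setP=> j; apply/imsetP/imP => [[i /domP[k ai] ->]|[i ai]].
  by exists i; rewrite /rook_fun ai.
by exists i; [apply/domP; exists j | rewrite /rook_fun ai].
Qed.

Lemma card_im a : #|im a| = #|dom a|.
Proof. by rewrite -rook_fun_dom card_rook_fun. Qed.

Lemma card_dom_rcomp a b : #|dom (rcomp a b)| = #|im a :&: dom b|.
Proof.
have sub : dom (rcomp a b) \subset dom a.
  by apply/subsetP=> i; rewrite !inE rcompE; case: (val a i).
rewrite -(card_rook_fun sub); apply: eq_card => j; rewrite inE.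
apply/imsetP/andP => [[i + ->]|[/imP[i ai] /domP[k bj]]].
  rewrite inE rcompE /rook_fun; case ai: (val a i) => [k|] //= bk; split.
    by apply/imP; exists i.
  by rewrite inE.
exists i; last by rewrite /rook_fun ai.
by rewrite inE rcompE ai /= bj.
Qed.

(** Inclusion-exclusion: loops are the middle vertices outside [im a] and [dom b], while the rank of
    the product counts their intersection. This is the identity of exponents that removes the
    twist. *)
Lemma rook_loops_card a b :
  (rook_loops a b + (n - #|dom (rcomp a b)|) = (n - #|dom a|) + (n - #|dom b|))%N.
Proof.
have -> : rook_loops a b = #|~: (im a :|: dom b)|.
  apply: eq_card => j; rewrite !inE negb_or negb_exists negbK.
  by congr (_ && _); apply: eq_forallb.
rewrite card_dom_rcomp -(card_im a) cardsCs setCK card_ord cardsU.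
have le_card S : (#|S| <= n)%N by rewrite -[X in (_ <= X)%N]card_ord max_card.
have := le_card (im a); have := le_card (dom b); have := le_card (im a :|: dom b).
have := subset_leq_card (subsetIl (im a) (dom b)).
have := subset_leq_card (subsetIr (im a) (dom b)).
rewrite cardsU; move: #|im a| #|dom b| #|im a :&: dom b| => p q m; lia.
Qed.

End RookCat.

(** * Untwisting the rook algebra *)

Section Untwist.
Variables (F : fieldType) (n : nat) (x : F).
Hypothesis x_neq0 : x != 0.
Local Notation A := (catalg F (rookcat n)).
Local Notation "''d' g" := (delta F (g : rookcat n)) (at level 8, g at level 2).
Implicit Types (a b c w : rook n).

Definition down a : A := \sum_(w | rle w a) 'd w.

Lemma downE a w : down a w = (rle w a)%:R.
Proof. by rewrite /down sum_deltaE ffunE. Qed.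

Lemma odeltaE (o : option (rook n)) w : odelta F (o : option (rookcat n)) w = (o == Some w)%:R.
Proof.
case: o => [c|]; rewrite !ffunE //.
by congr (_ %:R); congr nat_of_bool; apply/eqP/eqP => [->|[->]].
Qed.

(** Each restriction of [rcomp a b] is, in exactly one way, a groupoid composite of a restriction of
    [a] and one of [b]; nothing else arises as such a composite. *)
Lemma downM a b : down a * down b = down (rcomp a b).
Proof.
apply/ffunP=> w; rewrite downE /down mulr_suml sum_ffunE.
under eq_bigr => a' _ do (rewrite mulr_sumr sum_ffunE;
  under eq_bigr => b' _ do rewrite delta_mul odeltaE).
case: (boolP (rle w (rcomp a b))) => [wab|nwab]; last first.
  rewrite big1 // => a' aa; rewrite big1 // => b' bb; case: eqP => //.
  rewrite /comp /= /pcomp; case: ifP => // _ [eqw].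
  by rewrite -eqw rle_rcomp in nwab.
pose a0 := rcomp (ridm (dom w)) a; pose b0 := rcomp (ridm (im a0)) b.
have uniq_ab a' b' : rle a' a -> rle b' b -> pcomp a' b' = Some w -> a' = a0 /\ b' = b0.
  move=> /rleP aa /rleP bb; rewrite /pcomp; case: eqP => // eqab [eqw].
  have da : dom a' = dom w by rewrite -eqw dom_rcomp.
  have a0E : a' = a0 by rewrite aa da.
  by split=> //; rewrite bb -eqab a0E.
rewrite (bigD1 a0) ?rle_restr //= [X in _ + X]big1 ?addr0 => [|a' /andP[aa na]]; last first.
  rewrite big1 // => b' bb; case: eqP => // /uniq_ab [] // eqa.
  by rewrite eqa eqxx in na.
rewrite (bigD1 b0) ?rle_restr //= [X in _ + X]big1 ?addr0 => [|b' /andP[bb nb]]; last first.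
  case: eqP => // /uniq_ab [] // ; first exact: rle_restr.
  by move=> _ eqb; rewrite eqb eqxx in nb.
by rewrite (rle_factor wab) eqxx.
Qed.

Definition untwist (u : Ln F n) : A := \sum_a (u a * x ^+ (n - #|dom a|)) *: down a.

Lemma untwistP k (u v : Ln F n) :
  untwist [ffun w => k * u w + v w] = k *: untwist u + untwist v.
Proof.
rewrite /untwist scaler_sumr -big_split; apply: eq_bigr => a _ /=.
by rewrite ffunE mulrDl scalerDl -mulrA -scalerA.
Qed.

Lemma untwistM (u v : Ln F n) : untwist (Ln_mul x u v) = untwist u * untwist v.
Proof.
rewrite mulr_suml.
under [RHS]eq_bigr => a _.
  rewrite mulr_sumr.
  under eq_bigr => b _.
    rewrite -scalerAl -scalerAr downM scalerA mulrACA -exprD -rook_loops_card exprD.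
    over.
  over.
rewrite /untwist /Ln_mul; under [LHS]eq_bigr => c _.
  rewrite ffunE mulr_suml scaler_suml.
  under eq_bigr => a _.
    rewrite big_mkcond /= mulr_suml scaler_suml.
    over.
  over.
rewrite exchange_big /=; apply: eq_bigr => a _.
rewrite exchange_big /=; apply: eq_bigr => b _.
rewrite (bigD1 (rcomp a b)) //= [X in _ + X]big1 ?addr0 => [|c nc]; last first.
  rewrite ifN ?mul0r ?scale0r //; apply: contra nc => /eqP abc.
  by apply/eqP/val_inj/(etrans (esym abc))/ffunP=> i; rewrite !ffunE.
rewrite ifT ?mulrA //; apply/eqP/ffunP=> i; rewrite !ffunE.
Qed.

(** The restrictions of the identity diagram are the partial identities, whose sum is the unit of
    the groupoid algebra. *)
Lemma untwist1 : untwist (Ln_one F n) = 1.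
Proof.
have idE a : (val a == [ffun i => Some i]) = (a == ridm [set: 'I_n]).
  rewrite -val_eqE; congr (_ == _); apply/ffunP=> i; rewrite !ffunE.
  by rewrite inE.
rewrite /untwist (bigD1 (ridm [set: 'I_n])) //= [X in _ + X]big1 ?addr0 => [|a na]; last first.
  by rewrite ffunE idE (negPf na) mul0r scale0r.
rewrite ffunE idE eqxx dom_ridm cardsT card_ord subnn mulr1 scale1r.
apply/ffunP=> w; rewrite downE catalg_1E sum_deltaE ffunE; congr (_ %:R); congr nat_of_bool.
apply/idP/imsetP => [/rleP->|[S _ ->]].
  exists (dom w) => //; apply/rookP => i; rewrite rcompE !ridmE.
  by case: ifP => //= _; rewrite ridmE inE.
by apply/forallP=> i; rewrite !ridmE inE; case: ifP; rewrite ?eqxx ?orbT.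
Qed.

(** The map is triangular: the coefficient at [a] involves only the extensions of [a]. Proper
    extensions have larger domains and are handled by induction; the power of [x] left at [a] itself
    is nonzero. *)
Lemma untwist_inj0 (u : Ln F n) : untwist u = 0 -> u = 0.
Proof.
move=> u0; apply/ffunP=> a; rewrite ffunE.
have [m] := ubnP (n - #|dom a|); elim: m a => // m IHm a; rewrite ltnS => am.
have := congr1 (fun f : A => f a) u0; rewrite /= sum_ffunE ffunE (bigD1 a) //=.
rewrite [X in _ + X]big1 => [|b nb]; last first.
  rewrite ffunE downE; case: (boolP (rle a b)) => [ab|]; last by rewrite scaler0.
  rewrite IHm ?mul0r ?scale0r //; apply: leq_trans am.
  have dab : (#|dom a| < #|dom b|)%N.
    apply: proper_card; rewrite properEneq dom_rle // andbT.
    apply: contraNneq nb => eqd; apply/eqP/rookP => i.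
    case: (boolP (i \in dom a)) => ia; first by rewrite (rle_val ab).
    by rewrite (notin_dom ia) notin_dom // -eqd.
  have : (#|dom b| <= n)%N by rewrite -[X in (_ <= X)%N]card_ord max_card.
  by move: dab; move: #|dom a| #|dom b| => p q; lia.
have raa : rle a a by apply/forallP=> i; rewrite eqxx orbT.
rewrite addr0 ffunE downE raa /GRing.scale /= mulr1 => /eqP.
by rewrite mulf_eq0 expf_eq0 (negPf x_neq0) andbF orbF => /eqP.
Qed.

Lemma untwist_bij : bijective untwist.
Proof.
have lin : linear (untwist : A -> A).
  move=> k u v; rewrite -untwistP; congr untwist.
  by apply/ffunP=> w; rewrite !ffunE.
(* Source and target are both functions on diagrams, so [untwist] is an endomorphism of a
   finite-dimensional space, where a zero kernel implies bijectivity. *)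
pose L := GRing.isLinear.Build F A A _ (untwist : A -> A) lin.
pose f : {linear A -> A} := HB.pack (untwist : A -> A) L.
have fE u : linfun f u = untwist u by rewrite lfunE.
have ker0 : lker (linfun f) == 0%VS.
  by rewrite -subv0; apply/subvP=> u; rewrite memv_ker memv0 fE => /eqP/untwist_inj0 ->.
exists (linfun f)^-1%VF => u; first by rewrite -fE lker0_lfunK.
by rewrite -fE lker0_lfunVK.
Qed.

End Untwist.

(** * Symmetric groups inside the groupoid *)

HB.instance Definition _ r := Finite.on (ytype r).

Section SymInRook.
Variables (n r : nat) (le_rn : (r <= n)%N).

Definition initial : {set 'I_n} := [set i : 'I_n | (i < r)%N].

Lemma card_initial : #|initial| = r.
Proof.
rewrite -[RHS]card_ord -(card_imset _ (f := widen_ord le_rn)) => [|k k' /(congr1 val)/=].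
  apply: eq_card => i; rewrite inE; apply/idP/imsetP => [ir|[k _ ->]]; last by case: k.
  by exists (Ordinal ir) => //; apply: val_inj.
exact: val_inj.
Qed.

Definition sym_rook_fun (s : 'S_r) (i : 'I_n) : option 'I_n :=
  omap (fun k => widen_ord le_rn (s k)) (insub (i : nat)).

Lemma sym_rook_funE s (k : 'I_r) :
  sym_rook_fun s (widen_ord le_rn k) = Some (widen_ord le_rn (s k)).
Proof. by rewrite /sym_rook_fun /= valK. Qed.

Lemma sym_rook_funN s (i : 'I_n) : (r <= i)%N -> sym_rook_fun s i = None.
Proof. by move=> ri; rewrite /sym_rook_fun insubN // -leqNgt. Qed.

Variant initial_spec (i : 'I_n) : bool -> Prop :=
| InitialYes k of i = widen_ord le_rn k : initial_spec i true
| InitialNo of (r <= i)%N : initial_spec i false.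

Lemma initialP i : initial_spec i (i \in initial).
Proof.
rewrite inE; case: ltnP => ir; last by constructor.
by apply: (InitialYes (k := Ordinal ir)); apply: val_inj.
Qed.

Lemma widen_initial k : widen_ord le_rn k \in initial.
Proof. by rewrite inE /= ltn_ord. Qed.

Lemma widen_inj : injective (widen_ord le_rn).
Proof. by move=> k k' /(congr1 val) /= /val_inj. Qed.

Lemma sym_rook_pinj s : pinj (sym_rook_fun s).
Proof.
move=> i i' j; case: (initialP i) => [k ->|/sym_rook_funN -> //].
case: (initialP i') => [k' ->|/sym_rook_funN -> //].
by rewrite !sym_rook_funE => -[<-] [/val_inj/perm_inj ->].
Qed.

(** This identifies the symmetric group with the automorphism group of the object [initial] in the
    groupoid. *)
Definition sym_rook s : rook n := mkrook (@sym_rook_pinj s).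

Lemma sym_rookE s k : val (sym_rook s) (widen_ord le_rn k) = Some (widen_ord le_rn (s k)).
Proof. by rewrite mkrookE sym_rook_funE. Qed.

Lemma dom_sym_rook s : dom (sym_rook s) = initial.
Proof.
apply/setP=> i; case: (initialP i) => [k ->|ri]; first by rewrite inE sym_rookE.
by rewrite inE mkrookE sym_rook_funN.
Qed.

Lemma im_sym_rook s : im (sym_rook s) = initial.
Proof.
apply/setP=> j; case: (initialP j) => [k ->|rj].
  by apply/imP; exists (widen_ord le_rn (s^-1 k)%g); rewrite sym_rookE permKV.
apply/negbTE/imP => -[i]; rewrite mkrookE.
case: (initialP i) => [k ->|/sym_rook_funN -> //].
by rewrite sym_rook_funE => -[jE]; rewrite -jE /= leqNgt ltn_ord in rj.
Qed.

Lemma sym_rookM s t : pcomp (sym_rook s) (sym_rook t) = Some (sym_rook (s * t)).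
Proof.
rewrite /pcomp im_sym_rook dom_sym_rook eqxx; congr Some; apply/rookP => i.
rewrite rcompE; case: (initialP i) => [k ->|ri];
  first by rewrite sym_rookE /= !sym_rookE permM.
by rewrite !mkrookE !sym_rook_funN.
Qed.

Lemma sym_rook1 : sym_rook 1 = ridm initial.
Proof.
apply/rookP => i; rewrite ridmE; case: (initialP i) => [k ->|ri].
  by rewrite sym_rookE perm1.
by rewrite mkrookE sym_rook_funN.
Qed.

Lemma sym_rook_inj : injective sym_rook.
Proof.
move=> s t /rookP st; apply/permP=> k; have := st (widen_ord le_rn k).
by rewrite !sym_rookE => -[/val_inj].
Qed.

Lemma sym_rook_onto d : dom d = initial -> im d = initial -> exists s, d = sym_rook s.
Proof.
move=> dd id; have /fin_all_exists[f fP] (k : 'I_r) :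
    exists k', val d (widen_ord le_rn k) = Some (widen_ord le_rn k').
  have /domP[j dj] : widen_ord le_rn k \in dom d by rewrite dd widen_initial.
  have : j \in initial by rewrite -id; apply/imP; exists (widen_ord le_rn k).
  by case: (initialP j) dj => // k' -> dk _; exists k'.
have f_inj : injective f.
  move=> k k' ff; apply: widen_inj; apply: (rook_inj (fP k)).
  by rewrite ff fP.
exists (perm f_inj); apply/rookP => i; case: (initialP i) => [k ->|ri].
  by rewrite sym_rookE permE fP.
by rewrite mkrookE sym_rook_funN // notin_dom // dd inE -leqNgt.
Qed.

Variable F : fieldType.
Local Notation A := (catalg F (rookcat n)).
Local Notation B := (catalg F (groupcat 'S_r)).
Local Notation "''r' a" := (delta F (a : rookcat n)) (at level 8, a at level 2).
Local Notation "''s' s" := (delta F (s : groupcat 'S_r)) (at level 8, s at level 2).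

(** This multiplicative embedding sends the unit to the idempotent of the object [initial], not to
    the unit of [A]. *)
Definition sym_emb (u : B) : A := locked (\sum_(s : 'S_r) u s *: 'r (sym_rook s)).

Lemma sym_emb_is_linear : linear sym_emb.
Proof.
move=> k u v; rewrite /sym_emb -!lock scaler_sumr -big_split; apply: eq_bigr => s _ /=.
by rewrite !ffunE scalerDl scalerA.
Qed.

HB.instance Definition _ := GRing.isLinear.Build F B A _ sym_emb sym_emb_is_linear.

Lemma sym_embE (s : 'S_r) : sym_emb 's s = 'r (sym_rook s).
Proof.
rewrite /sym_emb -lock (bigD1 s) //= big1 => [|t ts].
  by rewrite ffunE eqxx scale1r addr0.
by rewrite ffunE (negPf ts) scale0r.
Qed.

Lemma sym_embM u v : sym_emb (u * v) = sym_emb u * sym_emb v.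
Proof.
elim/galg_ind: u => [s||u u' IHu IHu'|k u IHu].
- elim/galg_ind: v => [t||v v' IHv IHv'|k v IHv].
  + by rewrite gdeltaM !sym_embE delta_mul /= sym_rookM.
  + by rewrite mulr0 linear0 mulr0.
  + by rewrite mulrDr !linearD /= mulrDr IHv IHv'.
  by rewrite -scalerAr !linearZ /= -scalerAr IHv.
- by rewrite mul0r linear0 mul0r.
- by rewrite mulrDl !linearD /= mulrDl IHu IHu'.
by rewrite -scalerAl !linearZ /= -scalerAl IHu.
Qed.

Lemma sym_emb1 : sym_emb 1 = 'r (ridm initial).
Proof. by rewrite -gdelta1 sym_embE sym_rook1. Qed.

Lemma sym_emb_coef u (s : 'S_r) : sym_emb u (sym_rook s) = u s.
Proof.
rewrite /sym_emb -lock sum_ffunE (bigD1 s) //= big1 => [|t ts].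
  by rewrite !ffunE eqxx addr0 /GRing.scale /= mulr1.
by rewrite !ffunE (inj_eq sym_rook_inj) eq_sym (negPf ts) scaler0.
Qed.

Lemma sym_emb_eq0 u : sym_emb u = 0 -> u = 0.
Proof. by move=> u0; apply/ffunP=> s; rewrite -sym_emb_coef u0 !ffunE. Qed.

(** An arrow survives both multiplications only if it starts and ends at [initial], and then it
    comes from a permutation by [sym_rook_onto]. *)
Lemma sym_emb_corner (a : A) : exists u, sym_emb 1 * a * sym_emb 1 = sym_emb u.
Proof.
rewrite (deltaE a); elim/big_rec: _ => [|d v _ [u uE]].
  by exists 0; rewrite mulr0 mul0r linear0.
rewrite mulrDr mulrDl uE -scalerAr -scalerAl sym_emb1 delta_mul.
have idI : ridm initial \in idents (rookcat n) by apply: ridm_ident.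
rewrite comp_idl //; case: eqP => /= [dd|_]; last by exists u; rewrite mul0r scaler0 add0r.
rewrite delta_mul comp_idr //; case: eqP => /= [id|_]; last by exists u; rewrite scaler0 add0r.
have [s ->] : exists s, d = sym_rook s.
  apply: sym_rook_onto; first by rewrite -(dom_ridm (dom d)) -dd dom_ridm.
  by rewrite -(dom_ridm (im d)) -id dom_ridm.
by exists (a (sym_rook s) *: 's s + u); rewrite linearP /= sym_embE.
Qed.

End SymInRook.

(** * Assembling the idempotents of all ranks *)

Section RookSplit.
Variables (F : fieldType) (n : nat).
Hypothesis charF : [pchar F] =i pred0.
Local Notation A := (catalg F (rookcat n)).
Local Notation "''r' a" := (delta F (a : rookcat n)) (at level 8, a at level 2).

Definition rook_type := {r : 'I_n.+1 & ytype r}.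

Lemma ord_le (r : 'I_n.+1) : (r <= n)%N. Proof. by rewrite -ltnS. Qed.

Definition emb (r : 'I_n.+1) := @sym_emb n r (ord_le r) F.

Definition rook_idem (i : rook_type) : A :=
  emb (sval (sym_split (tag i) charF) (tagged i)).

(** The domain and image of a partial bijection have the same size, so no arrow joins initial
    segments of different sizes. *)
Lemma emb_corner_neq (r s : 'I_n.+1) (a : A) : r != s ->
  emb (1 : catalg F (groupcat 'S_r)) * a * emb (1 : catalg F (groupcat 'S_s)) = 0.
Proof.
move=> nrs; rewrite (deltaE a) mulr_sumr mulr_suml big1 // => d _.
rewrite -scalerAr -scalerAl /emb !sym_emb1 delta_mul.
rewrite comp_idl ?ridm_ident //; case: eqP => /= [dd|_]; last by rewrite mul0r scaler0.
rewrite delta_mul comp_idr ?ridm_ident //; case: eqP => /= [id|_]; last by rewrite scaler0.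
case/eqP: nrs; apply: val_inj => /=.
rewrite -[LHS](card_initial (ord_le r)) -[RHS](card_initial (ord_le s)).
rewrite -(dom_ridm (initial n r)) dd dom_ridm -(dom_ridm (initial n s)) id dom_ridm.
by rewrite card_im.
Qed.

(** Every object is isomorphic to an initial segment: send each element of [S] to its position in
    [enum S]. *)
Lemma rook_path (S : {set 'I_n}) : exists d : rook n, dom d = S /\ im d = initial n #|S|.
Proof.
pose f (i : 'I_n) : option 'I_n := if i \in S then insub (index i (enum S)) else None.
have le_S : (#|S| <= n)%N by rewrite -[X in (_ <= X)%N]card_ord max_card.
have fS i : i \in S -> exists2 j, f i = Some j & val j = index i (enum S).
  move=> iS; rewrite /f iS; have lt_i : (index i (enum S) < n)%N.
    by apply: leq_trans le_S; rewrite cardE index_mem mem_enum.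
  by exists (Ordinal lt_i); rewrite ?insubT.
have fN i : i \notin S -> f i = None by rewrite /f => /negPf->.
have f_inj : pinj f.
  move=> i i' j; case: (boolP (i \in S)) => [iS|/fN-> //].
  case: (boolP (i' \in S)) => [iS'|/fN-> //].
  have [j1 -> j1E] := fS i iS; have [j2 -> j2E] := fS i' iS'.
  move=> [jj] [jj']; apply: (@index_inj _ i (enum S)); rewrite ?mem_enum // -j1E -j2E.
  by rewrite jj jj'.
exists (mkrook f_inj); split.
  apply/setP=> i; rewrite inE mkrookE; case: (boolP (i \in S)) => [iS|/fN-> //].
  by have [j ->] := fS i iS.
apply/setP=> j; rewrite [RHS]inE; apply/imP/idP => [[i]|jS].
  rewrite mkrookE; case: (boolP (i \in S)) => [iS|/fN-> //].
  have [j' -> j'E] := fS i iS => -[<-].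
  by rewrite j'E cardE index_mem mem_enum.
have jS' : (j < size (enum S))%N by rewrite -cardE.
exists (nth j (enum S) j); rewrite mkrookE.
have nS : nth j (enum S) j \in S by rewrite -mem_enum mem_nth.
have [k -> kE] := fS _ nS.
by congr Some; apply: val_inj; rewrite kE index_uniq ?enum_uniq.
Qed.

Lemma ideal_emb (r : 'I_n.+1) u (a b : A) :
  ideal (sval (sym_split r charF)) u -> ideal rook_idem (a * emb u * b).
Proof.
rewrite /emb; elim=> [|v w _ IHv _ IHw|l i t].
- by rewrite linear0 mulr0 mul0r; apply: ideal0.
- by rewrite linearD mulrDr mulrDl; apply: idealD.
rewrite !sym_embM !mulrA -(mulrA _ _ b).
exact: (ideal_gen _ (a * _) (existT _ r i) (_ * b)).
Qed.

Lemma rook_split : split_family rook_idem.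
Proof.
have splitr r := svalP (sym_split r charF).
split=> [i|i|i a|i j a nij|].
- apply/eqP => /sym_emb_eq0/eqP; apply/negP.
  by have [+ _ _ _ _] := splitr (tag i); apply.
- rewrite /rook_idem /emb -sym_embM.
  by have [_ -> _ _ _] := splitr (tag i).
- have [u uE] := sym_emb_corner (ord_le (tag i)) a.
  have [_ _ + _ _] := splitr (tag i) => /(_ (tagged i) u)[k kE].
  exists k; rewrite /rook_idem /emb.
  rewrite -{1}[sval _ _]mulr1 -{2}[sval _ _]mul1r !sym_embM !mulrA.
  by rewrite -2!(mulrA (sym_emb _ (sval _ _))) uE -!sym_embM kE linearZ.
(* For equal ranks, orthogonality comes from the symmetric group algebra; for different ranks there
   is no arrow between the two objects. *)
- case: i j nij => r i [s j] /= nij; rewrite /rook_idem /=.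
  have [rs|nrs] := eqVneq r s.
    subst s; have {}nij : i != j by apply: contraNneq nij => ->.
    have [u uE] := sym_emb_corner (ord_le r) a.
    have [_ _ _ + _] := splitr r => /(_ i j u nij) orth.
    rewrite /emb -[sval _ i]mulr1 -[sval _ j]mul1r !sym_embM !mulrA.
    by rewrite -2!(mulrA (sym_emb _ (sval _ _))) uE -!sym_embM orth linear0.
  rewrite /emb -[sval _ i]mulr1 -[sval _ j]mul1r !sym_embM !mulrA.
  by rewrite -2!(mulrA (sym_emb _ (sval _ _))) emb_corner_neq // mulr0 mul0r.
(* The unit is the sum of the object idempotents; each is carried along a path to that of an initial
   segment, which is in the ideal because 1 lies in the ideal of the symmetric group algebra. *)
rewrite catalg_1E; apply: ideal_sum => e /imsetP[S _ ->].
have [d [dS dI]] := rook_path S.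
have lt_S : (#|S| < n.+1)%N by rewrite ltnS -[X in (_ <= X)%N]card_ord max_card.
have -> : 'r (ridm S) = 'r d * emb (1 : catalg F (groupcat 'S_(Ordinal lt_S))) * 'r (rinv d).
  rewrite /emb sym_emb1 delta_mul comp_idr ?ridm_ident //= -dI eqxx /=.
  by rewrite delta_mul /= pcomp_rinv dS.
by apply: ideal_emb; have [_ _ _ _] := splitr #|S|.
Qed.

End RookSplit.

Lemma split_family_enum_val (F : fieldType) (A : algType F) (I : finType) (e : I -> A) :
  split_family e -> split_family (fun k : 'I_#|I| => e (enum_val k)).
Proof.
case=> e_neq0 e_idem e_corner e_orth e_full; split=> // [i j a nij|].
  by apply: e_orth; rewrite (inj_eq enum_val_inj).
elim: e_full => [|u v _ IHu _ IHv|l i r]; first exact: ideal0.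
  exact: idealD.
by rewrite -[i]enum_rankK; apply: (ideal_gen (fun k => e (enum_val k))).
Qed.

Theorem theorem4p1 (F : fieldType) (hchar : [pchar F] =i pred0)
  (n : nat) (x : F) (hx : x != 0) : Ln_semisimple n x.
Proof.
pose A := catalg F (rookcat n).
pose bas (k : 'I_#|{: rook n}|) : A := delta F (enum_val k : rookcat n).
have bas_span (a : A) : exists f, a = \sum_k f k *: bas k.
  exists (fun k => a (enum_val k)); rewrite [LHS]deltaE.
  rewrite (reindex (fun k : 'I_#|{: rook n}| => enum_val k)) //.
  by exists enum_rank => k _; rewrite ?enum_valK ?enum_rankK.
have [d [phi [d_gt0 phiP phiM phi1 phi_bij]]] :=
  split_family_semisimple bas_span (split_family_enum_val (rook_split n hchar)).
exists _, d, (fun u => phi (untwist x u)); split=> //.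
- by move=> c u v i; rewrite untwistP phiP.
- by move=> u v i; rewrite untwistM phiM.
- by move=> i; rewrite untwist1.
exact: bij_comp phi_bij (untwist_bij n hx).
Qed.
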